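(* Let $(G,\alpha,\mathcal F)$ be conservationist, let $x>0$, and let $F$ be an $x\times\alpha$-flow of $G$. Then there is a unique positive layering-simplex combination $F=\sum_{L\in\mathcal L}a_L J(L)$ for $F$ (i.e. a unique layering-simplex $\mathcal L$ and unique coefficients $a_L>0$). Moreover, if $F$ is integer-valued, then all coefficients $a_L$ are integers.
   Context: All graphs are finite. $G=(V,E)$ is a DAG; $\mathrm{in}(v),\mathrm{out}(v)$ are incoming/outgoing edges. An $x\times\alpha$-flow is $F:E\to\mathbb R_{\ge0}$ with $\sum_{e\in\mathrm{out}(i)}F(e)-\sum_{e\in\mathrm{in}(i)}F(e)=x\alpha_i$ for all $i$. A netflow vector $\alpha\in\mathbb Z^V$ is conservationist if $\alpha_i=1$ at every source, $\alpha_i<0$ at every sink, $\alpha_i=0$ at every internal vertex; then $S_\alpha$ (the number of sources) is the strength. A framing $\mathcal F$: a total order on $\mathrm{out}(i)$ for each non-sink $i$, on $\mathrm{in}(i)$ for each internal $i$, and a total order $s_1<\dots<s_{S_\alpha}$ on the sources. $(G,\alpha,\mathcal F)$ is conservationist if $\alpha$ is conservationist and $\mathcal F$ a framing. A route is a directed path from a source to a sink; $I(p)\in\mathbb R^E$ is its edge indicator vector. For distinct paths $p,q$ from a vertex $i$ to a sink, let the maximal common initial subpath end at $v$, with $p$ then using $f$, $q$ using $g$; $p<_i^+q$ if $f<g$ in the order on $\mathrm{out}(v)$. For distinct paths from a source to a non-sink $i$, let the maximal common final subpath $\sigma$ start at $v$, $p\supseteq f\sigma$, $q\supseteq g\sigma$;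 $p<_i^-q$ if $f<g$ in the order on $\mathrm{in}(v)$. For routes through $i$ compare the portions after (resp. before) $i$. Routes are incompatible at a shared vertex $i$ if (up to swapping) $p<_i^-q$ and $q<_i^+p$; compatible otherwise. A route-clique is a set of pairwise compatible routes. A layering is a set $L$ of routes with exactly one route beginning at each source and exactly $|\alpha_j|$ ending at each sink $j$; write $L_i$ for the route starting at $s_i$, and $J(L)=\sum_{p\in L}I(p)$. For distinct layerings, $L<_{\mathrm{src}}^+M$ if $L_i<_{s_i}^+M_i$ for the maximal $i$ with $L_i\ne M_i$. $\mathrm{routes}(\mathcal L)$ is the union of the layerings in $\mathcal L$. A set $\mathcal L=\{L^1<_{\mathrm{src}}^+\dots<_{\mathrm{src}}^+L^m\}$ of layerings is a layering-simplex if (1) $\mathrm{routes}(\mathcal L)$ is a route-clique; (2) each $L^i$ is the $<_{\mathrm{src}}^+$-minimum among all layerings contained in $\mathrm{routes}(\{L^i,\dots,L^m\})$; (3) each $L^i$ contains a route not in $\mathrm{routes}(\{L^{i+1},\dots,L^m\})$. A layering-simplex combination is $\sum_{L\in\mathcal L}a_LJ(L)$ with $\mathcal L$ a layering-simplex and $a_L\ge0$; positive if all $a_L>0$. *)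

(* Defs.v *)
From HB Require Import structures.
From mathcomp Require Import all_boot all_order all_algebra.
From mathcomp Require Import reals.

Set Implicit Arguments.
Unset Strict Implicit.
Unset Printing Implicit Defensive.

Import Order.TTheory GRing.Theory Num.Theory.
Local Open Scope ring_scope.

Definition consecutive (V E : finType) (src tgt : E -> V) : rel E :=
  fun e f => tgt e == src f.

(* Parallel edges are allowed. *)
Record dag := Dag {
  vert : finType;
  edge : finType;
  esrc : edge -> vert;
  etgt : edge -> vert;
  dag_acyclic :
    forall c : seq edge, cycle (consecutive esrc etgt) c -> c = [::]
}.

Definition total_order_on (T : eqType) (A : {pred T}) (le : rel T) : Prop :=
  [/\ {in A, reflexive le}, {in A &, antisymmetric le},
      {in A & &, transitive le} & {in A &, total le}].

Section Graph.

Variable G : dag.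
Implicit Types (i j s t v : vert G) (e f g : edge G).

Definition out_edges v : {set edge G} := [set e | esrc e == v].
Definition in_edges v : {set edge G} := [set e | etgt e == v].

Definition is_source v : bool := in_edges v == set0.
Definition is_sink v : bool := out_edges v == set0.
Definition is_internal v : bool := ~~ is_source v && ~~ is_sink v.

Definition conservationist (alpha : vert G -> int) : Prop :=
  forall v, [/\ is_source v -> alpha v = 1,
                is_sink v -> alpha v < 0
              & is_internal v -> alpha v = 0].

Definition is_flow (R : realType) (x : R) (alpha : vert G -> int)
    (F : edge G -> R) : Prop :=
  (forall e, 0 <= F e) /\
  (forall v, \sum_(e in out_edges v) F e - \sum_(e in in_edges v) F e
             = x * (alpha v)%:~R).

(* The orders are reflexive; their values outside of the indicated sets are
   unconstrained and never matter. *)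
Record framing := Framing {
  out_le : vert G -> rel (edge G);
  in_le : vert G -> rel (edge G);
  source_le : rel (vert G);
  out_leP : forall v, ~~ is_sink v ->
    total_order_on (mem (out_edges v)) (out_le v);
  in_leP : forall v, is_internal v ->
    total_order_on (mem (in_edges v)) (in_le v);
  source_leP : total_order_on is_source source_le
}.

Definition starts_at (p : seq (edge G)) v : bool :=
  if p is e :: _ then esrc e == v else false.

Definition ends_at (p : seq (edge G)) v : bool :=
  if p is e :: p' then etgt (last e p') == v else false.

(* This requires p to be nonempty.  An empty route would need a vertex that is
   both a source and a sink, which a conservationist netflow excludes. *)
Definition is_route (p : seq (edge G)) : bool :=
  [&& sorted (consecutive (@esrc G) (@etgt G)) p,
      [exists v, is_source v && starts_at p v]
    & [exists v, is_sink v && ends_at p v]].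

(* In an acyclic graph a directed path repeats no edge, so bounding the length
   by #|edge G| loses no route and makes the type of routes finite. *)
Record route := Route {
  route_bseq :> #|edge G|.-bseq (edge G);
  route_isP : is_route route_bseq
}.

HB.instance Definition _ := [isSub for route_bseq].
HB.instance Definition _ := [Equality of route by <:].
HB.instance Definition _ := [Choice of route by <:].
HB.instance Definition _ := [Countable of route by <:].
HB.instance Definition _ := [Finite of route by <:].

Implicit Types (p q : route) (L M K : {set route}).

Definition indicator (R : realType) p : edge G -> R :=
  fun e => (e \in route_bseq p)%:R.

Definition visits p v : bool :=
  has (fun e => (esrc e == v) || (etgt e == v)) p.

(* The portions of a route through v before and after v.  When v is the final
   sink, [find] returns the length of the route. *)
Definition before p v : seq (edge G) := take (find (fun e => esrc e == v) p) p.
Definition after p v : seq (edge G) := drop (find (fun e => esrc e == v) p) p.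

(* The relation r at the first position where the two sequences differ. *)
Fixpoint first_diff (T : eqType) (r : rel T) (a b : seq T) : bool :=
  match a, b with
  | e :: a', f :: b' => if e == f then first_diff r a' b' else r e f
  | _, _ => false
  end.

Section Framed.

Variable Fr : framing.

(* lt_out v p q is p <_v^+ q and lt_in v p q is p <_v^- q.  The edges compared
   are distinct and share their source (resp. target), which is the end
   (resp. start) of the maximal common subpath. *)
Definition lt_out v p q : bool :=
  first_diff (fun f g => out_le Fr (esrc f) f g) (after p v) (after q v).

Definition lt_in v p q : bool :=
  first_diff (fun f g => in_le Fr (etgt f) f g)
    (rev (before p v)) (rev (before q v)).

Definition incompatible_at v p q : bool :=
  [&& visits p v, visits q v
    & (lt_in v p q && lt_out v q p) || (lt_in v q p && lt_out v p q)].

Definition compatible p q : bool := ~~ [exists v, incompatible_at v p q].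

Definition route_clique K : bool :=
  [forall p in K, forall q in K, compatible p q].

Definition is_layering (alpha : vert G -> int) L : Prop :=
  (forall s, is_source s -> #|[set p in L | starts_at p s]| = 1%N) /\
  (forall j, is_sink j -> #|[set p in L | ends_at p j]| = `|alpha j|%N).

(* For a layering this is the singleton of its route starting at s. *)
Definition route_from L s : {set route} := [set p in L | starts_at p s].

Definition layering_lt L M : bool :=
  [exists s, [&& is_source s, route_from L s != route_from M s,
    [forall t, is_source t && (route_from L t != route_from M t)
               ==> source_le Fr t s]
    & [exists p in route_from L s, exists q in route_from M s, lt_out s p q]]].

Definition routes (Ls : seq {set route}) : {set route} := \bigcup_(L <- Ls) L.

Definition is_min_layering (alpha : vert G -> int) K L : Prop :=
  [/\ is_layering alpha L, L \subset K
    & forall M, is_layering alpha M -> M \subset K -> M != L ->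
        layering_lt L M].

Definition layering_simplex (alpha : vert G -> int)
    (LL : {set {set route}}) : Prop :=
  exists Ls : seq {set route},
    [/\ LL = [set L in Ls],
        {in Ls, forall L, is_layering alpha L},
        sorted layering_lt Ls,
        route_clique (routes Ls)
      & forall (Ls1 Ls2 : seq {set route}) L, Ls = Ls1 ++ L :: Ls2 ->
          is_min_layering alpha (routes (L :: Ls2)) L /\
          exists2 p, p \in L & p \notin routes Ls2].

Definition layering_indicator (R : realType) L : edge G -> R :=
  fun e => \sum_(p in L) indicator R p e.

Definition positive_combination (R : realType) (alpha : vert G -> int)
    (LL : {set {set route}}) (a : {set route} -> R)
    (F : edge G -> R) : Prop :=
  [/\ layering_simplex alpha LL,
      {in LL, forall L, 0 < a L}
    & forall e, F e = \sum_(L in LL) a L * layering_indicator R L e].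

End Framed.

End Graph.

(* Main.v *)
Require Import Defs.
From mathcomp Require Import all_boot all_order all_algebra.
From mathcomp Require Import reals zify lra.

Set Implicit Arguments.
Unset Strict Implicit.
Unset Printing Implicit Defensive.

Import Order.TTheory GRing.Theory Num.Theory.
Local Open Scope ring_scope.

(* Fill every edge e with particles occupying heights [0, F e).  At each internal
   vertex stack the incoming and the outgoing edges in the order of the framing
   and let particles keep their height when crossing the vertex.  The set of
   particles following a route is an interval whose length is the weight of that
   route; since particles never cross, the routes of positive weight form a
   clique.  Conversely, in any clique decomposition of F the routes through an
   edge are linearly ordered, consistently along the edges, so that stacking them
   places each route inside its own interval of particles, and comparing total
   weights shows that the decomposition is the one by particles.

   The route weights are balanced, so Hall's theorem yields a layering inside
   their support.  Subtracting the largest possible multiple of the least such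
   layering and iterating produces the layering-simplex, and conditions (2) and
   (3) force each step, whence uniqueness.  Only minima, sums and differences of
   values of F occur, so integrality is preserved. *)

(** * Least elements and stacks of weighted blocks *)

Lemma exists_least (T : finType) (A : {set T}) (le : rel T) :
    A != set0 -> {in A & &, transitive le} -> {in A &, total le} ->
  exists2 m, m \in A & {in A, forall x, le m x}.
Proof.
move=> /set0Pn[x0 x0A] le_trans le_total.
(* Take [m] with the fewest elements below it. Were [le m x] false, totality and transitivity would
   put the down-set of [x] strictly inside that of [m]. *)
case: (arg_minnP (fun m => #|[set y in A | le y m]|) x0A) => m; rewrite -/(m \in A) => mA min_m.
exists m => // x xA; case/orP: (le_total _ _ mA xA) => // le_xm.
apply: contraLR (min_m x xA) => not_le_mx; rewrite -ltnNge; apply: proper_card.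
apply/properP; split.
  apply/subsetP => y; rewrite !inE => /andP[yA le_yx]; rewrite yA /=.
  exact: (le_trans x).
exists m; last by rewrite inE mA.
by rewrite inE mA; have := le_total _ _ mA mA; rewrite orbb.
Qed.

Section Stacking.

Variables (R : realFieldType) (T : finType).
Implicit Types (A : {set T}) (le : rel T) (w : T -> R).

Lemma ler_sum_subpred (P Q : pred T) w :
  (forall x, 0 <= w x) -> subpred P Q -> \sum_(x | P x) w x <= \sum_(x | Q x) w x.
Proof.
move=> w_ge0 sPQ; rewrite big_mkcond [leRHS]big_mkcond ler_sum // => x _.
by have := sPQ x; case: (P x) => [-> //|_]; case: (Q x).
Qed.

(** The height of the bottom of the block of [x] when the elements of [A] are stacked in the order
    [le] as blocks of height [w]. *)
Definition offset A le w x : R := \sum_(y in A | (y != x) && le y x) w y.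

Variables (A : {set T}) (le : rel T) (w : T -> R).
Hypothesis leP : total_order_on (mem A) le.

Lemma offsetD x : x \in A -> offset A le w x + w x = \sum_(y in A | le y x) w y.
Proof.
case: leP => refl _ _ _ xA.
rewrite [RHS](bigD1 x) /=; last by rewrite xA refl.
rewrite addrC; congr (_ + _); apply: eq_bigl => y.
by rewrite -andbA [le y x && _]andbC.
Qed.

Hypothesis w_ge0 : forall x, 0 <= w x.

Lemma offset_ge0 x : 0 <= offset A le w x.
Proof. exact: sumr_ge0. Qed.

Lemma offsetD_le x : x \in A -> offset A le w x + w x <= \sum_(y in A) w y.
Proof. by move=> xA; rewrite offsetD //; apply: ler_sum_subpred => // y /andP[]. Qed.

(** Whatever is at most [x] lies below [y] by transitivity and differs from [y] by antisymmetry, so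
    distinct blocks do not overlap. *)
Lemma offset_separated x y : x \in A -> y \in A -> x != y -> le x y ->
  offset A le w x + w x <= offset A le w y.
Proof.
case: (leP) => _ anti trans _ xA yA neq_xy le_xy.
rewrite offsetD //; apply: ler_sum_subpred => // z /andP[zA le_zx].
rewrite zA (trans x) // andbT; apply: contraNneq neq_xy => eq_zy.
by apply/eqP/anti; rewrite // le_xy -eq_zy le_zx.
Qed.

End Stacking.

(** Consecutive blocks share an endpoint, so the increments of [phi] telescope. The induction
    removes the maximum [m]: its block is on top, and the offsets of the other elements do not
    involve it. *)
Lemma telescope_offset (R : realFieldType) (T : finType) (A : {set T})
    (le : rel T) (w : T -> R) (phi : R -> R) :
    total_order_on (mem A) le ->
  \sum_(x in A) (phi (offset A le w x + w x) - phi (offset A le w x))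
  = phi (\sum_(x in A) w x) - phi 0.
Proof.
have [n] := ubnP #|A|; elim: n => // n IHn in A * => leAn leP.
have [-> | A_neq0] := eqVneq A set0; first by rewrite !big_set0 subrr.
case: (leP) => refl anti trans tot.
have [||m mA max_m] := @exists_least _ A (fun x y => le y x) A_neq0.
- by move=> y x z yA xA zA /= h1 h2; apply: (trans y).
- by move=> x y xA yA /=; apply: tot.
have lePm : total_order_on (mem (A :\ m)) le.
  have sub : {subset mem (A :\ m) <= mem A} by move=> x /=; rewrite !inE => /andP[].
  split; [exact: sub_in1 refl | exact: sub_in2 anti | exact: sub_in3 trans
         | exact: sub_in2 tot].
rewrite (big_setD1 m) //=.
rewrite (eq_bigr (fun x => phi (offset (A :\ m) le w x + w x)
                           - phi (offset (A :\ m) le w x))); last first.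
  move=> x; rewrite !inE => /andP[neq_xm xA].
  suff -> : offset (A :\ m) le w x = offset A le w x by [].
  apply: eq_bigl => y; rewrite !inE; case: eqVneq => //= ->.
  rewrite mA /=; apply/esym/negP => /andP[_ le_mx].
  by move/eqP: neq_xm; apply; apply: anti => //; rewrite le_mx max_m.
rewrite IHn ?lePm //; last by rewrite (cardsD1 m A) mA in leAn.
rewrite addrA; congr (_ - _).
have -> : offset A le w m = \sum_(x in A :\ m) w x.
  apply: eq_bigl => y; rewrite !inE; case yA : (y \in A); rewrite ?andbF //=.
  by rewrite max_m // andbT.
by rewrite [in RHS](big_setD1 m) //= [w m + _]addrC subrK.
Qed.

(** * Routes in a DAG *)

Lemma mem_split (T : eqType) (x : T) (r : seq T) :
  x \in r -> exists X Y, r = X ++ x :: Y.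
Proof. by case/splitPr => X Y; exists X, Y. Qed.

Lemma first_diff_irrefl (T : eqType) (r : rel T) (s : seq T) : first_diff r s s = false.
Proof. by elim: s => //= x s IHs; rewrite eqxx. Qed.

Lemma first_diff_neq_nil (T : eqType) (r : rel T) (P Q : seq T) :
  first_diff r P Q -> P <> [::] /\ Q <> [::].
Proof. by case: P; case: Q. Qed.

Section Routes.

Variable G : dag.
Implicit Types (v : vert G) (e f : edge G) (s X Y P : seq (edge G)).
Implicit Types p q : route G.

Local Notation cons_edges := (consecutive (@esrc G) (@etgt G)).

Lemma path_no_return e s : path cons_edges e s -> etgt (last e s) != esrc e.
Proof.
move=> es; apply/eqP => ret.
by have /dag_acyclic: cycle cons_edges (e :: s)
  by rewrite /= rcons_path es /consecutive ret eqxx.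
Qed.

Lemma sorted_mid X e Y : sorted cons_edges (X ++ e :: Y) -> path cons_edges e Y.
Proof. by case: X => [|x X] //=; rewrite cat_path /= => /and3P[]. Qed.

Lemma sorted_linked s e f : sorted cons_edges s -> e \in s -> f \in s -> e != f ->
  exists Y, path cons_edges e (rcons Y f) \/ path cons_edges f (rcons Y e).
Proof.
move=> s_path e_s; case/splitPr: e_s s_path => X Y s_path.
rewrite mem_cat inE eq_sym => /or3P[f_X|-> //|f_Y] _.
  case/splitPr: f_X s_path => X1 X2; rewrite -catA /= => /sorted_mid.
  by rewrite -cat_rcons cat_path => /andP[h _]; exists X2; right.
case/splitPr: f_Y s_path => Y1 Y2 /sorted_mid.
by rewrite -cat_rcons cat_path => /andP[h _]; exists Y1; left.
Qed.

Lemma path_src_neq e f s : path cons_edges e (rcons s f) -> esrc e != esrc f.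
Proof.
rewrite rcons_path eq_sym => /andP[/path_no_return h /eqP <-]; exact: h.
Qed.

Lemma path_tgt_neq e f s : path cons_edges e (rcons s f) -> etgt e != etgt f.
Proof.
case: s => [|g s] /= /andP[/eqP -> h]; rewrite eq_sym.
  exact: (@path_no_return f [::]).
by have := path_no_return h; rewrite last_rcons.
Qed.

(** The subpath linking two distinct edges with the same source would close up to a cycle. *)
Lemma sorted_src_inj s : sorted cons_edges s -> {in s &, injective (@esrc G)}.
Proof.
move=> s_path e f e_s f_s eq_src; apply/eqP; apply: contraT => neq_ef.
have [Y [] /path_src_neq] := sorted_linked s_path e_s f_s neq_ef;
  by rewrite eq_src eqxx.
Qed.

Lemma sorted_tgt_inj s : sorted cons_edges s -> {in s &, injective (@etgt G)}.
Proof.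
move=> s_path e f e_s f_s eq_tgt; apply/eqP; apply: contraT => neq_ef.
have [Y [] /path_tgt_neq] := sorted_linked s_path e_s f_s neq_ef;
  by rewrite eq_tgt eqxx.
Qed.

Lemma consecutive_uniq s : sorted cons_edges s -> uniq s.
Proof.
elim: s => //= e s IHs e_s; rewrite IHs ?(path_sorted e_s) // andbT.
apply/negP => /splitPr e_in; case: s / e_in e_s {IHs} => X Y.
rewrite -cat_rcons cat_path => /andP[/path_src_neq]; by rewrite eqxx.
Qed.

Lemma route_sorted p : sorted cons_edges p.
Proof. by have /and3P[] := route_isP p. Qed.

Lemma route_head p e s : p = e :: s :> seq _ -> is_source (esrc e).
Proof.
by move=> eq_p; have /and3P[_ /existsP[v /andP[vs]]] := route_isP p;
  rewrite eq_p /= => /eqP ->.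
Qed.

Lemma route_last p e s : p = rcons s e :> seq _ -> is_sink (etgt e).
Proof.
move=> eq_p; have /and3P[_ _ /existsP[v /andP[vs]]] := route_isP p.
by rewrite eq_p; case: s {eq_p} => [|f s] /= /eqP; rewrite ?last_rcons => ->.
Qed.

Lemma route_neq_nil p : p <> [::] :> seq _.
Proof. by move=> eq_p; have /and3P[_ /existsP[v]] := route_isP p; rewrite eq_p andbF. Qed.

Lemma out_not_sink e : ~~ is_sink (esrc e).
Proof. by apply/set0Pn; exists e; rewrite inE. Qed.

Lemma in_not_source e : ~~ is_source (etgt e).
Proof. by apply/set0Pn; exists e; rewrite inE. Qed.

Lemma route_next p e : e \in (p : seq _) -> ~~ is_sink (etgt e) ->
  exists2 f, f \in (p : seq _) & esrc f = etgt e.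
Proof.
case/mem_split => X [[|f Y]] eq_p.
  by move: eq_p; rewrite cats1 => /route_last ->.
exists f; first by rewrite eq_p mem_cat !inE eqxx !orbT.
by have := route_sorted p; rewrite eq_p => /sorted_mid /andP[/eqP ->].
Qed.

Lemma route_prev p e : e \in (p : seq _) -> ~~ is_source (esrc e) ->
  exists2 f, f \in (p : seq _) & etgt f = esrc e.
Proof.
case/mem_split => X [Y]; case: (lastP X) => [/route_head -> //|{}X f eq_p] _.
exists f; first by rewrite eq_p mem_cat mem_rcons inE eqxx.
by have := route_sorted p; rewrite eq_p cat_rcons => /sorted_mid /andP[/eqP ->].
Qed.

(** Inside [q] each vertex has at most one outgoing edge, so two paths in [q] that begin at the same
    vertex and end at sinks agree edge by edge. The first edge of [p] leaves a source, so no edge of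
    [q] precedes it, and both routes begin at the same vertex. *)
Lemma sub_route p q : {subset (p : seq _) <= (q : seq _)} -> p = q.
Proof.
have tails : forall P Q, sorted cons_edges P -> sorted cons_edges Q ->
    (forall e s, P = rcons s e -> is_sink (etgt e)) ->
    (forall e s, Q = rcons s e -> is_sink (etgt e)) ->
    {subset P <= (q : seq _)} -> {subset Q <= (q : seq _)} ->
    (forall e s f t, P = e :: s -> Q = f :: t -> esrc e = esrc f) ->
    P <> [::] -> Q <> [::] -> P = Q.
  elim=> [|e P IHP] [|f Q] // eP fQ Plast Qlast subP subQ eq_src _ _.
  have eq_ef : e = f.
    apply: (sorted_src_inj (route_sorted q)); last exact: eq_src.
      by apply: subP; rewrite mem_head.
    by apply: subQ; rewrite mem_head.
  rewrite eq_ef in eP Plast *; congr (_ :: _); clear eq_src.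
  case: P => [|e' P] in IHP eP Plast subP *; case: Q => [|f' Q] in fQ Qlast subQ *.
  - by [].
  - have := Plast f [::] erefl; have /andP[/eqP -> _] := fQ.
    by rewrite (negPf (out_not_sink _)).
  - have := Qlast f [::] erefl; have /andP[/eqP -> _] := eP.
    by rewrite (negPf (out_not_sink _)).
  - move: eP fQ => /= /andP[/eqP ee' eP] /andP[/eqP ff' fQ].
    apply: IHP => //.
    + by move=> g s eq_s; apply: (Plast g (f :: s)); rewrite eq_s.
    + by move=> g s eq_s; apply: (Qlast g (f :: s)); rewrite eq_s.
    + by move=> g gP; apply: subP; rewrite inE gP orbT.
    + by move=> g gQ; apply: subQ; rewrite inE gQ orbT.
    + by move=> _ _ _ _ [<- _] [<- _]; rewrite -ee'.
move=> sub_pq; apply/val_inj/val_inj/tails => //=; try exact: route_sorted.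
- by move=> e s; apply: route_last.
- by move=> e s; apply: route_last.
- move=> e s f t eq_p eq_q; have := route_head eq_p; apply: contraTeq => neq_src.
  have /mem_split[X [Y eq_q']] : e \in (q : seq _).
    by apply: sub_pq; rewrite eq_p mem_head.
  case: (lastP X) eq_q' => [|{}X g] eq_q'.
    by move: neq_src; rewrite eq_q in eq_q'; case: eq_q' => ->; rewrite eqxx.
  have := route_sorted q; rewrite eq_q' cat_rcons => /sorted_mid /andP[/eqP <- _].
  exact: in_not_source.
- exact: route_neq_nil.
- exact: route_neq_nil.
Qed.

Lemma mem_out v e : (e \in out_edges v) = (esrc e == v).
Proof. by rewrite inE. Qed.

Lemma mem_in v e : (e \in in_edges v) = (etgt e == v).
Proof. by rewrite inE. Qed.

Lemma sum_out_route (R : pzSemiRingType) p e v : e \in (p : seq _) -> esrc e = v ->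
  \sum_(f in out_edges v) (f \in (p : seq _))%:R = 1 :> R.
Proof.
move=> e_p eq_v; rewrite (bigD1 e) /=; last by rewrite mem_out eq_v.
rewrite e_p big1 ?addr0 // => f; rewrite mem_out => /andP[/eqP eq_f neq_f].
case f_p: (f \in _) => //; case/eqP: neq_f.
by apply: (sorted_src_inj (route_sorted p)); rewrite ?eq_f.
Qed.

Lemma sum_in_route (R : pzSemiRingType) p e v : e \in (p : seq _) -> etgt e = v ->
  \sum_(f in in_edges v) (f \in (p : seq _))%:R = 1 :> R.
Proof.
move=> e_p eq_v; rewrite (bigD1 e) /=; last by rewrite mem_in eq_v.
rewrite e_p big1 ?addr0 // => f; rewrite mem_in => /andP[/eqP eq_f neq_f].
case f_p: (f \in _) => //; case/eqP: neq_f.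
by apply: (sorted_tgt_inj (route_sorted p)); rewrite ?eq_f.
Qed.

Lemma route_conservation (R : pzSemiRingType) p v : is_internal v ->
  \sum_(f in out_edges v) (f \in (p : seq _))%:R
  = \sum_(e in in_edges v) (e \in (p : seq _))%:R :> R.
Proof.
case/andP => v_src v_snk.
have [e /andP[e_p /eqP eq_v]|no_in] := pickP (fun e => (e \in (p : seq _)) && (etgt e == v)).
  have [|f f_p eq_f] := route_next e_p; first by rewrite eq_v.
  by rewrite (sum_out_route _ f_p) ?eq_f // (sum_in_route _ e_p).
rewrite [RHS]big1 => [|e]; last first.
  by rewrite mem_in => eq_v; have := no_in e; rewrite eq_v andbT => ->.
rewrite big1 // => f; rewrite mem_out => /eqP eq_v; case f_p: (f \in _) => //.
have [|e e_p eq_e] := route_prev f_p; first by rewrite eq_v.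
by have := no_in e; rewrite e_p eq_e eq_v eqxx.
Qed.

Lemma starts_at_out p v : is_source v ->
  starts_at p v = has (fun e => esrc e == v) p.
Proof.
move=> v_src; apply/idP/hasP => [|[e /mem_split[X [Y eq_p]] /eqP eq_v]].
  by case eq_p: (p : seq _) => [|e s] //= eq_v; exists e; rewrite ?mem_head.
case: (lastP X) eq_p => [->|{}X g eq_p]; first by rewrite /= eq_v.
have := route_sorted p; rewrite eq_p cat_rcons => /sorted_mid /andP[/eqP eq_g _].
by move: (in_not_source g); rewrite eq_g eq_v v_src.
Qed.

Lemma ends_at_in p v : is_sink v -> ends_at p v = has (fun e => etgt e == v) p.
Proof.
move=> v_snk; apply/idP/hasP => [|[e /mem_split[X [Y eq_p]] /eqP eq_v]].
  case/lastP eq_p: (p : seq _) => [|s e] //.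
  case: s eq_p => [|f s] /= _; first by move=> eq_v; exists e; rewrite ?inE.
  by rewrite last_rcons => eq_v; exists e; rewrite // -rcons_cons mem_rcons mem_head.
case: Y eq_p => [|g Y] eq_p.
  by rewrite eq_p; case: X {eq_p} => [|f X] /=; rewrite ?last_cat /= eq_v.
have := route_sorted p; rewrite eq_p => /sorted_mid /andP[/eqP eq_g _].
by move: (out_not_sink g); rewrite -eq_g eq_v v_snk.
Qed.

Lemma sum_out_source (R : pzSemiRingType) p v : is_source v ->
  \sum_(e in out_edges v) (e \in (p : seq _))%:R = (starts_at p v)%:R :> R.
Proof.
move=> v_src; rewrite starts_at_out //; case: hasP => [[e e_p /eqP eq_v]|no_e].
  exact: sum_out_route e_p eq_v.
rewrite big1 // => e; rewrite mem_out => eq_v; case e_p: (e \in _) => //.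
by case: no_e; exists e.
Qed.

Lemma sum_in_sink (R : pzSemiRingType) p v : is_sink v ->
  \sum_(e in in_edges v) (e \in (p : seq _))%:R = (ends_at p v)%:R :> R.
Proof.
move=> v_src; rewrite ends_at_in //; case: hasP => [[e e_p /eqP eq_v]|no_e].
  exact: sum_in_route e_p eq_v.
rewrite big1 // => e; rewrite mem_in => eq_v; case e_p: (e \in _) => //.
by case: no_e; exists e.
Qed.

Lemma path_starts_at e s : path cons_edges e s -> s <> [::] -> starts_at s (etgt e).
Proof. by case: s => [|f s] //= /andP[/eqP-> _] _. Qed.

(** A route leaves each vertex at most once, so the [find] in [before] and [after] cannot stop
    early. At the target of [e] with [Y] empty it finds nothing and returns the length of the route,
    which is again the right cut. *)
Lemma route_portions p X e Y : p = X ++ e :: Y :> seq _ ->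
  [/\ before p (esrc e) = X, after p (esrc e) = e :: Y,
      before p (etgt e) = rcons X e & after p (etgt e) = Y].
Proof.
move=> eq_p; have p_path := route_sorted p.
have e_p : e \in (p : seq _) by rewrite eq_p mem_cat mem_head orbT.
have find_src : find (fun f => esrc f == esrc e) p = size X.
  rewrite eq_p find_cat /= eqxx addn0 ifN //; apply/hasPn => f fX; apply/eqP => eq_src.
  have eq_fe : f = e.
    by apply: (sorted_src_inj p_path); rewrite // eq_p mem_cat fX.
  have := consecutive_uniq p_path; rewrite eq_p cat_uniq => /and3P[_ /hasPn + _].
  by move/(_ e); rewrite mem_head -{1}eq_fe fX => /(_ isT).
have find_tgt : find (fun f => esrc f == etgt e) p = size (rcons X e).
  rewrite eq_p -cat_rcons find_cat ifN; last first.
    apply/hasPn => f; rewrite mem_rcons inE => /predU1P[->|].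
      by rewrite eq_sym; apply: (@path_no_return e [::]).
    case/mem_split => X1 [X2 eq_X]; move: p_path; rewrite eq_p eq_X -catA /=.
    move=> /sorted_mid; rewrite -cat_rcons cat_path => /andP[/path_no_return + _].
    by rewrite last_rcons eq_sym.
  move: p_path; rewrite eq_p => /sorted_mid; case: Y {eq_p} => [|f Y] /=.
    by rewrite addn0.
  by rewrite /consecutive eq_sym => /andP[-> _]; rewrite addn0.
rewrite /before /after find_src find_tgt eq_p.
by rewrite take_size_cat // drop_size_cat // -cat_rcons take_size_cat // drop_size_cat.
Qed.

Lemma after_neq_nil v p : after p v <> [::] ->
  exists e Y, [/\ p = before p v ++ e :: Y :> seq _, esrc e = v & after p v = e :: Y].
Proof.
move=> after_nil; have : has (fun e => esrc e == v) p.
  by apply: contra_notT after_nil => no_e; rewrite /after hasNfind // drop_size.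
case/hasP => e /mem_split[X [Y eq_p]] /eqP <-; exists e, Y.
by have [-> -> _ _] := route_portions eq_p.
Qed.

End Routes.

(** * Clique decompositions of flows *)

Section Stacks.

Variables (R : realFieldType) (G : dag) (Fr : framing G) (F : edge G -> R).
Implicit Types (v : vert G) (e f : edge G) (P s X Y : seq (edge G)) (p q : route G).
Implicit Types (t u : R).

Local Notation cons_edges := (consecutive (@esrc G) (@etgt G)).

Definition out_offset e := offset (out_edges (esrc e)) (out_le Fr (esrc e)) F e.
Definition in_offset e := offset (in_edges (etgt e)) (in_le Fr (etgt e)) F e.

(** The length of the part of the block of [e] lying below height [t] in the outgoing stack at its
    source. *)
Definition portion e t : R :=
  Num.min t (out_offset e + F e) - Num.min t (out_offset e).

(* The particles at the initial vertex of the path P are ordered by height;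
   [cumul P t] is the measure of those of height below t that follow P.  A
   particle at height t on the outgoing stack which lies on the edge e reaches
   the incoming stack of the target at height [t - out_offset e + in_offset e]. *)
Fixpoint cumul P t : R :=
  if P is e :: P' then
    cumul P' (in_offset e + portion e t) - cumul P' (in_offset e)
  else t.

(** The measure of all particles on the first edge that follow the rest of [P], without a cut-off
    height. The value on the empty path is a default. *)
Definition mass P : R :=
  if P is e :: P' then cumul P' (in_offset e + F e) - cumul P' (in_offset e)
  else 0.

Hypothesis F_ge0 : forall e, 0 <= F e.

Lemma out_offset_ge0 e : 0 <= out_offset e.
Proof. exact: offset_ge0. Qed.

Lemma in_offset_ge0 e : 0 <= in_offset e.
Proof. exact: offset_ge0. Qed.

Lemma out_offsetD_le e : out_offset e + F e <= \sum_(f in out_edges (esrc e)) F f.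
Proof.
by apply: offsetD_le; rewrite ?inE //; apply: out_leP; apply: out_not_sink.
Qed.

Lemma in_offsetD_le e : is_internal (etgt e) ->
  in_offset e + F e <= \sum_(f in in_edges (etgt e)) F f.
Proof. by move=> v_int; apply: offsetD_le; rewrite ?inE //; apply: in_leP. Qed.

Lemma portion_mono e : {homo portion e : t u / t <= u}.
Proof.
move=> t u le_tu; rewrite /portion; have := F_ge0 e.
set c := out_offset e => F0.
by case: (leP t (c + F e)); case: (leP t c); case: (leP u (c + F e)); case: (leP u c); lra.
Qed.

Lemma portion_ge0 e t : 0 <= portion e t.
Proof.
rewrite /portion; have := F_ge0 e; set c := out_offset e => F0.
by case: (leP t (c + F e)); case: (leP t c); lra.
Qed.

Lemma portion_le e t : portion e t <= F e.
Proof.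
rewrite /portion; have := F_ge0 e; set c := out_offset e => F0.
by case: (leP t (c + F e)); case: (leP t c); lra.
Qed.

Lemma portion_in e t : 0 <= t <= F e -> portion e (out_offset e + t) = t.
Proof.
rewrite /portion; have := F_ge0 e; set c := out_offset e => F0 /andP[t0 tF].
by case: (leP (c + t) (c + F e)); case: (leP (c + t) c); lra.
Qed.

Lemma portion_low e t : t <= out_offset e -> portion e t = 0.
Proof.
rewrite /portion; have := F_ge0 e; set c := out_offset e => F0.
by case: (leP t (c + F e)); case: (leP t c); lra.
Qed.

Lemma portion_high e t : out_offset e + F e <= t -> portion e t = F e.
Proof.
rewrite /portion; have := F_ge0 e; set c := out_offset e => F0.
by case: (leP t (c + F e)); case: (leP t c); lra.
Qed.

Lemma cumul_mono P : {homo cumul P : t u / t <= u}.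
Proof.
elim: P => //= e P IHP t u le_tu; rewrite lerD2r; apply: IHP.
by rewrite lerD2l; apply: portion_mono.
Qed.

Lemma mass_ge0 P : 0 <= mass P.
Proof. by case: P => //= e P; rewrite subr_ge0 cumul_mono // lerDl. Qed.

Lemma mass_cumul e P t : out_offset e + F e <= t -> mass (e :: P) = cumul (e :: P) t.
Proof. by move=> le_t /=; rewrite portion_high. Qed.

Hypothesis F_cons : forall v, is_internal v ->
  \sum_(e in out_edges v) F e = \sum_(e in in_edges v) F e.

(** The incoming blocks at [v] tile the heights from 0 to the total inflow, so the sum telescopes to
    the increment of [cumul (f :: P)] over that range. By conservation the range is the whole
    outgoing stack and contains the block of [f]. *)
Lemma mass_left f P v : is_internal v -> esrc f = v ->
  \sum_(e in in_edges v) mass (e :: f :: P) = mass (f :: P).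
Proof.
move=> v_int eq_v; pose phi := cumul (f :: P).
rewrite (eq_bigr (fun e => phi (offset (in_edges v) (in_le Fr v) F e + F e)
                     - phi (offset (in_edges v) (in_le Fr v) F e))).
  rewrite telescope_offset; last exact: in_leP.
  rewrite -F_cons // -eq_v /phi -mass_cumul ?out_offsetD_le //.
  by rewrite [cumul _ 0]/= portion_low ?out_offset_ge0 // addr0 subrr subr0.
by move=> e; rewrite mem_in /phi /in_offset /= => /eqP <-.
Qed.

(** Each particle leaves the end of the path through exactly one edge. For empty [P] the portions of
    the outgoing blocks below [t] telescope to [t]; the bounds on [t] keep it within the stack, and
    they persist along the path. *)
Lemma cumul_right e P t : path cons_edges e P -> is_internal (etgt (last e P)) ->
    in_offset e <= t <= in_offset e + F e ->
  \sum_(f in out_edges (etgt (last e P))) cumul (rcons P f) t = cumul P t.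
Proof.
elim: P e t => [|e' P IHP] e t /=.
  move=> _ v_int /andP[t_ge t_le]; set v := etgt e.
  pose phi := Num.min t.
  rewrite (eq_bigr (fun f => phi (offset (out_edges v) (out_le Fr v) F f + F f)
                     - phi (offset (out_edges v) (out_le Fr v) F f))).
    rewrite telescope_offset; last by apply: out_leP; case/andP: v_int.
    rewrite F_cons // /phi min_l; last exact: le_trans t_le (in_offsetD_le v_int).
    by rewrite min_r ?subr0 // (le_trans (in_offset_ge0 e)).
  by move=> f; rewrite mem_out /phi /portion /out_offset addrC addKr => /eqP ->.
move=> /andP[_ e'P] v_int _;
by rewrite sumrB !IHP // ?lexx lerDl ?lerD2l ?portion_ge0 ?portion_le ?F_ge0.
Qed.

Lemma mass_right e P : path cons_edges e P -> is_internal (etgt (last e P)) ->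
  \sum_(f in out_edges (etgt (last e P))) mass (rcons (e :: P) f) = mass (e :: P).
Proof.
move=> eP v_int; by rewrite /= sumrB !(cumul_right eP) // ?lexx ?andbT lerDl F_ge0.
Qed.

(** Extend [P] backwards to a source and then forwards to a sink, splitting its mass over the
    possible extensions. A fully extended path is a route, and by [sub_route] the only route
    containing it. *)
Lemma mass_routes P : P <> [::] -> sorted cons_edges P ->
  \sum_(p : route G) mass p * (all (mem (p : seq _)) P)%:R = mass P.
Proof.
(* A path repeats no edge, so its length is at most [#|edge G|] and the number of possible
   extensions bounds the induction. *)
have [n] := ubnP (#|edge G|.+1 - size P); elim: n => // n IHn in P *.
move=> lt_n P_nil P_path.
have P_size : (size P <= #|edge G|)%N
  by rewrite -(card_uniqP (consecutive_uniq P_path)) max_card.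
case: P => // e P in lt_n P_nil P_path P_size *.
have lt_n' : (#|edge G|.+1 - (size (e :: P)).+1 < n)%N.
  by rewrite -ltnS (leq_trans _ lt_n) // ltnS subSS subSn.
have [e_src|e_src] := boolP (is_source (esrc e)); last first.
  have v_int : is_internal (esrc e) by rewrite /is_internal e_src out_not_sink.
  rewrite -(mass_left P v_int erefl).
  transitivity (\sum_(e' in in_edges (esrc e)) \sum_(p : route G)
      mass p * (all (mem (p : seq _)) (e' :: e :: P))%:R); last first.
    by apply: eq_bigr => e'; rewrite mem_in => eq_e'; apply: IHn; rewrite //= /consecutive eq_e'.
  rewrite exchange_big /=; apply: eq_bigr => p _; rewrite -mulr_sumr; congr (_ * _).
  have [e_p|_] /= := boolP (e \in _); last by rewrite big1 // => e' _; rewrite andbF.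
  case: (all _ P); last by rewrite big1 // => e' _; rewrite andbF.
  (* A route through [e] enters the source of [e] by exactly one edge, so it is counted for exactly
     one extension. *)
  have [g g_p eq_g] := route_prev e_p e_src.
  rewrite (eq_bigr (fun e' => (e' \in (p : seq _))%:R)); last by move=> e' _; rewrite andbT.
  by rewrite (sum_in_route _ g_p eq_g).
have [v_snk|v_snk] := boolP (is_sink (etgt (last e P))); last first.
  have v_int : is_internal (etgt (last e P)) by rewrite /is_internal v_snk in_not_source.
  rewrite -(mass_right P_path v_int).
  transitivity (\sum_(f in out_edges (etgt (last e P))) \sum_(p : route G)
      mass p * (all (mem (p : seq _)) (rcons (e :: P) f))%:R); last first.
    apply: eq_bigr => f; rewrite mem_out => eq_f; apply: IHn; rewrite ?size_rcons //.
    by rewrite /= rcons_path [path _ _ _]P_path /= /consecutive eq_sym.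
  rewrite exchange_big /=; apply: eq_bigr => p _; rewrite -mulr_sumr; congr (_ * _).
  rewrite -[_ && _]/(all (mem (p : seq _)) (e :: P)).
  case P_p: (all _ (e :: P)); last first.
    rewrite big1 // => f _.
    by rewrite -[_ && _]/(all (mem (p : seq _)) (rcons (e :: P) f)) all_rcons P_p andbF.
  have l_p : last e P \in (p : seq _) by apply: (allP P_p); apply: mem_last.
  have [g g_p eq_g] := route_next l_p v_snk.
  rewrite (eq_bigr (fun f => (f \in (p : seq _))%:R)) ?(sum_out_route _ g_p eq_g) //.
  by move=> f _; rewrite -[_ && _]/(all (mem (p : seq _)) (rcons (e :: P) f)) all_rcons P_p andbT.
have P_route : is_route (Bseq P_size).
  apply/and3P; split=> //; apply/existsP.
    by exists (esrc e); rewrite e_src /= eqxx.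
  by exists (etgt (last e P)); rewrite v_snk /= eqxx.
rewrite (bigD1 (Route P_route)) //= mem_head /= big1 ?addr0.
  by rewrite (introT allP) ?mulr1 // => f; apply: (@mem_behead _ (e :: P)).
move=> p neq_p; case P_p: (_ && _); rewrite ?mulr0 //.
by case/eqP: neq_p; apply/esym/sub_route => f; apply: (allP (P_p : all _ (e :: P))).
Qed.

Lemma flow_mass e : F e = \sum_(p : route G) mass p * (e \in (p : seq _))%:R.
Proof.
transitivity (mass [:: e]); first by rewrite /= addrC addKr.
by rewrite -mass_routes //; apply: eq_bigr => p _; rewrite /= andbT.
Qed.

(** * Particles and the absence of crossings *)

(** The path taken by a single particle, given by its height [t] in the outgoing stack at the start
    of [P]; [height] below is its height at the end of [P]. *)
Fixpoint follows P t : Prop :=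
  if P is e :: P' then
    out_offset e <= t < out_offset e + F e
    /\ follows P' (in_offset e + (t - out_offset e))
  else True.

Fixpoint height P t : R :=
  if P is e :: P' then height P' (in_offset e + (t - out_offset e)) else t.

Lemma follows_cat X Y t : follows (X ++ Y) t <-> follows X t /\ follows Y (height X t).
Proof. by elim: X t => [|e X IHX] t /=; [tauto|rewrite IHX; tauto]. Qed.

Lemma height_rcons X e t :
  height (rcons X e) t = in_offset e + (height X t - out_offset e).
Proof. by elim: X t => /=. Qed.

(** A gain of measure between two heights must come from some particle in between. The induction
    finds one for the tail and moves it back across the first edge. *)
Lemma cumul_follows P t u : cumul P t < cumul P u ->
  exists2 h, t <= h < u & follows P h.
Proof.
elim: P t u => [|e P IHP] t u /=; first by exists t; rewrite ?lexx.
rewrite ltrD2r => /IHP[h /andP[ge_h lt_h] P_h].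
have : 0 <= portion e t by apply: portion_ge0.
have : portion e u <= F e by apply: portion_le.
move: ge_h lt_h; rewrite /portion.
set c := out_offset e; set b := in_offset e in P_h * => ge_h lt_h portion_u portion_t.
(* The inverse of the shift from the outgoing to the incoming height along [e]. *)
exists (c + (h - b)); last first.
  by split; [lra | have -> : b + (c + (h - b) - c) = h by lra].
have := F_ge0 e; move: ge_h lt_h portion_u portion_t.
by case: (leP t (c + F e)); case: (leP t c); case: (leP u (c + F e)); case: (leP u c); lra.
Qed.

Lemma mass_follows P : 0 < mass P -> exists h, follows P h.
Proof.
case: P => [|e P] /=; first by rewrite ltxx.
rewrite subr_gt0 => /cumul_follows[h h_in P_h].
set c := out_offset e; set b := in_offset e in P_h h_in *.
exists (c + (h - b)); split; first by lra.
by have -> : b + (c + (h - b) - c) = h by lra.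
Qed.

Lemma first_diff_out_height v P Q t u :
    sorted cons_edges P -> sorted cons_edges Q ->
    starts_at P v -> starts_at Q v -> follows P t -> follows Q u ->
    first_diff (fun f g => out_le Fr (esrc f) f g) P Q -> t < u.
Proof.
elim: P v Q t u => [|e P IHP] v [|f Q] t u //= P_path Q_path /eqP e_v /eqP f_v.
case=> /andP[ge_t lt_t] P_t [/andP[ge_u lt_u] Q_u].
have [eq_ef|neq_ef] := eqVneq e f.
  move=> PQ; rewrite -eq_ef in Q_u Q_path f_v.
  have P_nil : P <> [::] by case: (P) PQ.
  have Q_nil : Q <> [::] by case: (Q) PQ => //; case: (P).
  have := IHP (etgt e) Q _ _ (path_sorted P_path) (path_sorted Q_path)
    (path_starts_at P_path P_nil) (path_starts_at Q_path Q_nil) P_t Q_u PQ.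
  by rewrite ltrD2l ltrD2r.
move=> le_ef; apply: lt_le_trans lt_t _; apply: le_trans ge_u.
rewrite /out_offset e_v f_v.
apply: offset_separated => //; rewrite ?mem_out ?e_v ?f_v //; last by rewrite -e_v.
by apply: out_leP; rewrite -e_v out_not_sink.
Qed.

(** The mirror image of [first_diff_out_height]: going backwards from [v], the paths first differ in
    two separated incoming blocks, and the heights at the end are compared. *)
Lemma first_diff_in_height v P Q t u : is_internal v ->
    sorted cons_edges P -> sorted cons_edges Q -> ends_at P v -> ends_at Q v ->
    follows P t -> follows Q u ->
    first_diff (fun f g => in_le Fr (etgt f) f g) (rev P) (rev Q) ->
  height P t < height Q u.
Proof.
elim/last_ind: P v Q => [|P e IHP] v Q v_int.
  by rewrite /= => _ _ _ _.
case/lastP: Q => [|Q f]; first by rewrite rev_rcons.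
have end_rcons s g w : ends_at (rcons s g) w = (etgt g == w).
  by case: s => //= a s; rewrite last_rcons.
rewrite !end_rcons !rev_rcons !height_rcons -!cats1 !follows_cat /=.
move=> P_path Q_path /eqP e_v /eqP f_v [P_t [/andP[ge_e lt_e] _]] [Q_u [/andP[ge_f lt_f] _]].
have [eq_ef|neq_ef] := eqVneq e f.
  rewrite -eq_ef in f_v Q_path ge_f lt_f * => PQ.
  rewrite ltrD2l ltrD2r.
  have prefix s : sorted cons_edges (s ++ [:: e]) -> s <> [::] ->
      sorted cons_edges s /\ ends_at s (esrc e).
    by case: s => [|g s] //=; rewrite cat_path /= andbT => /andP[].
  have P_nil : P <> [::] by move=> eq_P; rewrite eq_P in PQ.
  have Q_nil : Q <> [::] by move=> eq_Q; rewrite eq_Q in PQ; case: (rev P) PQ.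
  have [Ps Pe] := prefix _ P_path P_nil; have [Qs Qe] := prefix _ Q_path Q_nil.
  apply: (IHP _ _ _ Ps Qs Pe Qe P_t Q_u PQ).
  rewrite /is_internal out_not_sink andbT; case/lastP: (P) Pe => // s g.
  by rewrite end_rcons => /eqP <-; apply: in_not_source.
move=> le_ef; apply: (@lt_le_trans _ _ (in_offset e + F e)); first by lra.
apply: (@le_trans _ _ (in_offset f)); last by lra.
rewrite /in_offset e_v f_v.
apply: offset_separated => //; rewrite ?mem_in ?e_v ?f_v //; last by rewrite -e_v.
exact: in_leP.
Qed.

(** Positive mass provides a particle on each route. Heights are kept across [v], but the incoming
    sides put the particle of [p] below that of [q] and the outgoing sides put it above. *)
Lemma crossing_mass v p q : 0 < mass p -> 0 < mass q ->
  lt_in Fr v p q -> lt_out Fr v q p -> False.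
Proof.
move=> /mass_follows[t p_t] /mass_follows[u q_u] in_pq out_qp.
have [/after_neq_nil[f [Yq [eq_q f_v after_q]]] /after_neq_nil[e [Yp [eq_p e_v after_p]]]] :=
  first_diff_neq_nil out_qp.
move: in_pq out_qp; rewrite /lt_in /lt_out after_p after_q => in_pq out_qp.
have portions (r : route G) X g Y : r = X ++ g :: Y :> seq _ -> esrc g = v -> X <> [::] ->
    [/\ sorted cons_edges X, ends_at X v, sorted cons_edges (g :: Y) & is_internal v].
  move=> eq_r g_v X_nil; have := route_sorted r; rewrite eq_r.
  case: X X_nil {eq_r} => //= h X _; rewrite cat_path => /and3P[-> /eqP eq_v gY].
  by split; rewrite ?eq_v ?g_v ?eqxx // /is_internal -g_v out_not_sink -eq_v in_not_source.
have [before_p before_q] : before p v <> [::] /\ before q v <> [::].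
  have [p_nil q_nil] := first_diff_neq_nil in_pq.
  by split=> eq_nil; [apply: p_nil | apply: q_nil]; rewrite eq_nil.
have [Xp Ep Sp v_int] := portions _ _ _ _ eq_p e_v before_p.
have [Xq Eq Sq _] := portions _ _ _ _ eq_q f_v before_q.
move: p_t q_u; rewrite eq_p eq_q => /follows_cat[Xp_t Yp_t] /follows_cat[Xq_u Yq_u].
have := first_diff_in_height v_int Xp Xq Ep Eq Xp_t Xq_u in_pq.
rewrite ltNge => /negP; apply; apply: ltW.
apply: first_diff_out_height Sq Sp _ _ Yq_u Yp_t out_qp; first exact/eqP/f_v.
exact/eqP.
Qed.

Lemma mass_clique : route_clique Fr [set p : route G | 0 < mass p].
Proof.
apply/forall_inP => p; rewrite inE => p_gt0; apply/forall_inP => q; rewrite inE => q_gt0.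
apply/negP => /existsP[v /and3P[_ _ /orP[] /andP[lt1 lt2]]].
  exact: (crossing_mass p_gt0 q_gt0 lt1 lt2).
exact: (crossing_mass q_gt0 p_gt0 lt1 lt2).
Qed.

(** * Uniqueness of clique decompositions *)

Section CliqueDecomposition.

Variable c : route G -> R.
Hypothesis c_ge0 : forall p, 0 <= c p.
Hypothesis c_clique : route_clique Fr [set p | 0 < c p].
Hypothesis F_c : forall e, F e = \sum_(p : route G) c p * (e \in (p : seq _))%:R.

(** Being lower on one side of [v] suffices: for routes of positive weight through [v], the clique
    condition forbids being higher on the other side. *)
Definition lies_below v q p := lt_in Fr v q p || lt_out Fr v q p.

(** Where the interval of [p] begins inside the block of [e] when the routes through [e] are
    themselves stacked with weights [c]. *)
Definition weight_below e p : R :=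
  \sum_q c q * (lies_below (esrc e) q p)%:R * (e \in (q : seq _))%:R.

(** Passing from one end of [e] to the other moves [e] between the two portions of each route, and
    [first_diff] skips a shared edge. *)
Lemma lies_below_edge e p q : e \in (p : seq _) -> e \in (q : seq _) ->
  lies_below (etgt e) q p = lies_below (esrc e) q p.
Proof.
case/mem_split => X [Y /route_portions[bp ap bp' ap']].
case/mem_split => X' [Y' /route_portions[bq aq bq' aq']].
rewrite /lies_below /lt_in /lt_out bp ap bp' ap' bq aq bq' aq'.
by rewrite !rev_rcons /= eqxx.
Qed.

Lemma lies_below_out e f p q : e \in (p : seq _) -> f \in (q : seq _) ->
  esrc e = esrc f -> e != f -> lt_out Fr (esrc f) q p = out_le Fr (esrc f) f e.
Proof.
case/mem_split => X [Y /route_portions[_ ap _ _]].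
case/mem_split => X' [Y' /route_portions[_ aq _ _]] eq_v neq_ef.
by rewrite /lt_out aq -eq_v ap /= eq_sym (negPf neq_ef) eq_v.
Qed.

Lemma lies_below_in e f p q : e \in (p : seq _) -> f \in (q : seq _) ->
  etgt e = etgt f -> e != f -> lt_in Fr (etgt f) q p = in_le Fr (etgt f) f e.
Proof.
case/mem_split => X [Y /route_portions[_ _ bp _]].
case/mem_split => X' [Y' /route_portions[_ _ bq _]] eq_v neq_ef.
by rewrite /lt_in bq -eq_v bp !rev_rcons /= eq_sym (negPf neq_ef) eq_v.
Qed.

Lemma clique_no_crossing v p q : 0 < c p -> 0 < c q -> visits p v -> visits q v ->
  lt_in Fr v p q -> lt_out Fr v q p -> False.
Proof.
move=> p_gt0 q_gt0 p_v q_v in_pq out_qp.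
move/forall_inP: c_clique => /(_ p); rewrite inE => /(_ p_gt0) /forall_inP/(_ q).
rewrite inE => /(_ q_gt0) /negP; apply; apply/existsP; exists v.
by rewrite /incompatible_at p_v q_v in_pq out_qp.
Qed.

Lemma visits_src e p : e \in (p : seq _) -> visits p (esrc e).
Proof. by move=> e_p; apply/hasP; exists e; rewrite ?eqxx. Qed.

Lemma visits_tgt e p : e \in (p : seq _) -> visits p (etgt e).
Proof. by move=> e_p; apply/hasP; exists e; rewrite ?eqxx ?orbT. Qed.

(** Both sides are the total weight of the routes leaving the vertex below [p]. A route on a lower
    edge [g] always lies below [p]; one of positive weight on a higher edge never does, since it
    would cross [p]. *)
Lemma weight_below_out f p : 0 < c p -> f \in (p : seq _) -> is_internal (esrc f) ->
  out_offset f + weight_below f p =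
  \sum_q c q * (lies_below (esrc f) q p)%:R
         * \sum_(g in out_edges (esrc f)) (g \in (q : seq _))%:R.
Proof.
move=> p_gt0 f_p v_int; set v := esrc f.
have [_ anti _ tot] := out_leP Fr (out_not_sink f).
under [RHS]eq_bigr do rewrite mulr_sumr.
rewrite exchange_big /= (bigD1 f) ?mem_out //= addrC; congr (_ + _).
rewrite /out_offset /offset.
transitivity (\sum_(g in out_edges v | g != f) (if out_le Fr v g f then F g else 0)).
  by rewrite -big_mkcondr /=; apply: eq_bigl => g; rewrite andbA.
apply: eq_bigr => g; rewrite mem_out => /andP[/eqP g_v neq_gf].
have eq_v : esrc f = esrc g by [].
have neq_fg : f != g by rewrite eq_sym.
case: ifP => le_gf.
  rewrite F_c; apply: eq_bigr => q _; case g_q: (g \in _); rewrite ?mulr0 //.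
  by rewrite /lies_below {2}/v eq_v (lies_below_out f_p g_q) // -eq_v le_gf orbT !mulr1.
rewrite big1 // => q _; case g_q: (g \in _); rewrite ?mulr0 // mulr1.
have := c_ge0 q; rewrite le0r => /predU1P[->|q_gt0]; first by rewrite mul0r.
have le_fg : out_le Fr v f g.
  by have := tot f g; rewrite !mem_out g_v eqxx => /(_ isT isT); rewrite le_gf orbF.
have out_pq : lt_out Fr v p q.
  by rewrite (lies_below_out g_q f_p _ neq_gf) // g_v.
rewrite /lies_below {2}/v eq_v (lies_below_out f_p g_q) // -eq_v le_gf orbF.
case in_qp: (lt_in _ _ _ _); rewrite ?mulr0 //.
case: (clique_no_crossing q_gt0 p_gt0 _ _ in_qp out_pq); last exact: visits_src.
by rewrite -g_v visits_src.
Qed.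

Lemma weight_below_in f p : 0 < c p -> f \in (p : seq _) -> is_internal (etgt f) ->
  in_offset f + weight_below f p =
  \sum_q c q * (lies_below (etgt f) q p)%:R
         * \sum_(g in in_edges (etgt f)) (g \in (q : seq _))%:R.
Proof.
move=> p_gt0 f_p v_int; set v := etgt f.
have [_ anti _ tot] := in_leP Fr v_int.
under [RHS]eq_bigr do rewrite mulr_sumr.
rewrite exchange_big /= (bigD1 f) ?mem_in //= addrC; congr (_ + _); last first.
  rewrite /weight_below; apply: eq_bigr => q _; case f_q: (f \in _); rewrite ?mulr0 //.
  by rewrite -lies_below_edge.
rewrite /in_offset /offset.
transitivity (\sum_(g in in_edges v | g != f) (if in_le Fr v g f then F g else 0)).
  by rewrite -big_mkcondr /=; apply: eq_bigl => g; rewrite andbA.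
apply: eq_bigr => g; rewrite mem_in => /andP[/eqP g_v neq_gf].
have eq_v : etgt f = etgt g by [].
have neq_fg : f != g by rewrite eq_sym.
case: ifP => le_gf.
  rewrite F_c; apply: eq_bigr => q _; case g_q: (g \in _); rewrite ?mulr0 //.
  by rewrite /lies_below {1}/v eq_v (lies_below_in f_p g_q) // -eq_v le_gf !mulr1.
rewrite big1 // => q _; case g_q: (g \in _); rewrite ?mulr0 // mulr1.
have := c_ge0 q; rewrite le0r => /predU1P[->|q_gt0]; first by rewrite mul0r.
have le_fg : in_le Fr v f g.
  by have := tot f g; rewrite !mem_in g_v eqxx => /(_ isT isT); rewrite le_gf orbF.
have in_pq : lt_in Fr v p q.
  by rewrite (lies_below_in g_q f_p _ neq_gf) // g_v.
rewrite /lies_below {1}/v eq_v (lies_below_in f_p g_q) // -eq_v le_gf /=.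
case out_qp: (lt_out _ _ _ _); rewrite ?mulr0 //.
case: (clique_no_crossing p_gt0 q_gt0 _ _ in_pq out_qp); first exact: visits_tgt.
by rewrite -g_v visits_tgt.
Qed.

(** By conservation of each route, the weight entering the vertex below [p] equals the weight
    leaving it below [p]. Hence the interval of [p] keeps its height across a vertex, as particles
    do. *)
Lemma weight_below_step e f p : 0 < c p -> e \in (p : seq _) -> f \in (p : seq _) ->
  etgt e = esrc f -> in_offset e + weight_below e p = out_offset f + weight_below f p.
Proof.
move=> p_gt0 e_p f_p eq_v.
have v_int : is_internal (etgt e) by rewrite /is_internal in_not_source eq_v out_not_sink.
rewrite weight_below_in // weight_below_out -?eq_v //.
by apply: eq_bigr => q _; rewrite route_conservation.
Qed.

Lemma weight_below_ge0 e p : 0 <= weight_below e p.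
Proof. by apply: sumr_ge0 => q _; rewrite !mulr_ge0 ?ler0n. Qed.

Lemma weight_below_le e p : e \in (p : seq _) -> weight_below e p + c p <= F e.
Proof.
move=> e_p; rewrite /weight_below F_c (bigD1 p) //= [leRHS](bigD1 p) //= e_p.
rewrite /lies_below /lt_in /lt_out !first_diff_irrefl /= mulr0 mul0r add0r mulr1.
rewrite [leRHS]addrC lerD2r ler_sum // => q _; apply: ler_wpM2r; first exact: ler0n.
by rewrite ler_piMr // lern1 leq_b1.
Qed.

(** The interval of length [c p] that starts at [weight_below] in the block of an edge of [p] is
    carried onto the corresponding interval of the next edge, so all its particles follow the rest
    of [p]. *)
Lemma cumul_weight_below X e Y p : 0 < c p -> p = X ++ e :: Y :> seq _ ->
  let h := in_offset e + weight_below e p in cumul Y (h + c p) - cumul Y h = c p.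
Proof.
move=> p_gt0; elim: Y X e => [|f Y IHY] X e eq_p /=; first by rewrite addrAC subrr add0r.
have e_p : e \in (p : seq _) by rewrite eq_p mem_cat mem_head orbT.
have f_p : f \in (p : seq _) by rewrite eq_p mem_cat !inE eqxx !orbT.
have eq_v : etgt e = esrc f.
  by have := route_sorted p; rewrite eq_p => /sorted_mid /andP[/eqP].
rewrite (weight_below_step p_gt0 e_p f_p eq_v) -(addrA (out_offset f)).
have w_ge0 := weight_below_ge0 f p; have w_le := weight_below_le f_p.
rewrite !portion_in ?(le_trans _ w_le) ?w_ge0 ?addr_ge0 ?lerDl //.
have := IHY (rcons X e) f; rewrite cat_rcons => /(_ eq_p) /=.
by rewrite -(addrA (in_offset f)); lra.
Qed.

Lemma clique_weight_le p : c p <= mass p.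
Proof.
have := c_ge0 p; rewrite le0r => /predU1P[->|p_gt0]; first exact: mass_ge0.
case eq_p: (p : seq _) => [|e P]; first by case: (@route_neq_nil _ p).
have e_p : e \in (p : seq _) by rewrite eq_p mem_head.
have /= <- := cumul_weight_below p_gt0 (eq_p : p = [::] ++ e :: P :> seq _).
rewrite lerB ?cumul_mono ?lerDl ?weight_below_ge0 //.
by rewrite -addrA lerD2l weight_below_le.
Qed.

(** The differences [mass q - c q] are nonnegative by [clique_weight_le], and over the routes
    through an edge [e] of [p] they sum to [F e - F e], so each of them vanishes. *)
Theorem clique_decomposition_unique p : c p = mass p.
Proof.
apply/eqP; rewrite eq_sym -subr_eq0.
have [e e_p] : exists e, e \in (p : seq _).
  case eq_p: (p : seq _) => [|e P]; first by case: (@route_neq_nil _ p).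
  by exists e; rewrite mem_head.
have : \sum_(q : route G) (mass q - c q) * (e \in (q : seq _))%:R == 0.
  by under eq_bigr do rewrite mulrBl; rewrite sumrB -flow_mass -F_c subrr.
rewrite psumr_eq0 => [/allP/(_ p)|q _]; last first.
  by rewrite mulr_ge0 ?ler0n // subr_ge0 clique_weight_le.
by move=> /(_ (mem_index_enum p)) /=; rewrite e_p mulr1.
Qed.

End CliqueDecomposition.

Lemma mass_zmod (S : zmodClosed R) P : (forall e, F e \in S) -> mass P \in S.
Proof.
move=> F_S.
have out_S e : out_offset e \in S by apply: rpred_sum.
have in_S e : in_offset e \in S by apply: rpred_sum.
have min_S t u : t \in S -> u \in S -> Num.min t u \in S by case: leP.
have portion_S e t : t \in S -> portion e t \in S.
  by move=> t_S; apply: rpredB; apply: min_S; rewrite // rpredD.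
have cumul_S : forall Q t, t \in S -> cumul Q t \in S.
  by elim=> //= e Q IHQ t t_S; apply: rpredB; apply: IHQ; rewrite // rpredD ?portion_S.
by case: P => [|e P] /=; [exact: rpred0 | apply: rpredB; apply: cumul_S; rewrite // rpredD].
Qed.

End Stacks.

(** * Layerings *)

(* Rado's argument: if a is not injective on K, then one of two elements with
   the same value can be removed without violating the hypothesis. *)
Lemma capacitated_hall (T S J : finType) (a : T -> S) (b : T -> J)
    (d : J -> nat) (K : {set T}) :
    (forall X : {set S}, X \subset a @: K ->
      (#|X| <= \sum_(j in b @: [set p in K | a p \in X]) d j)%N) ->
  exists L : {set T}, [/\ L \subset K, {in L &, injective a}, a @: L = a @: K
    & forall j, (#|[set p in L | b p == j]| <= d j)%N].
Proof.
pose N (K : {set T}) (X : {set S}) := b @: [set p in K | a p \in X].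
pose hall (K : {set T}) := [forall X : {set S},
  (X \subset a @: K) ==> (#|X| <= \sum_(j in N K X) d j)%N].
have dU (A B : {set J}) : (\sum_(j in A) d j + \sum_(j in B) d j
    = \sum_(j in A :|: B) d j + \sum_(j in A :&: B) d j)%N.
  rewrite 4!(big_mkcond (fun j => j \in _)) -!big_split; apply: eq_bigr => j _.
  by rewrite !inE; case: (j \in A); case: (j \in B); rewrite /= ?addn0.
have dS (A B : {set J}) : A \subset B -> (\sum_(j in A) d j <= \sum_(j in B) d j)%N.
  move=> /subsetP sAB; rewrite 2!(big_mkcond (fun j => j \in _)) leq_sum // => j _.
  by case jA: (j \in A) => //; rewrite sAB.
move=> hallK; have {hallK} : hall K by apply/forallP => X; apply/implyP/hallK.
have [n] := ubnP #|K|; elim: n => // n IHn in K * => ltKn hallK.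
have [a_inj | not_inj] := boolP (dinjectiveb a K).
  move/dinjectiveP: a_inj => a_inj; exists K; split=> // j.
  rewrite -(card_in_imset (f := a)); last first.
    by move=> p q; rewrite !inE => /andP[pK _] /andP[qK _]; apply: a_inj.
  (* For injective [a], the elements of [K] with value in [X] all lie over [j], so the hypothesis
     for [X] is the capacity bound at [j]. *)
  set X := a @: _.
  have sX : X \subset a @: K by apply: imsetS; apply/subsetP => p; rewrite inE => /andP[].
  have /implyP/(_ sX)/leq_trans := forallP hallK X; apply.
  rewrite -[leqRHS](big_set1 addn j d) dS //; apply/subsetP => _ /imsetP[p + ->].
  rewrite !inE => /andP[pK /imsetP[q]]; rewrite inE => /andP[qK /eqP <-] eq_pq.
  by rewrite (a_inj p q).
have {not_inj} /dinjectivePn[p pK [q]] := not_inj.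
rewrite !inE => /andP[neq_qp qK] eq_a.
have image_D1 r r' : r' \in K -> r' != r -> a r = a r' -> a @: (K :\ r) = a @: K.
  move=> r'K neq_r eq_r; apply/setP => s; apply/imsetP/imsetP => -[t tK ->].
    by exists t => //; case/setD1P: tK.
  have [->|neq_t] := eqVneq t r; first by exists r'; rewrite // !inE neq_r.
  by exists t; rewrite // !inE neq_t.
have remove r r' : r \in K -> r' \in K -> r' != r -> a r = a r' -> hall (K :\ r) ->
    exists L : {set T}, [/\ L \subset K, {in L &, injective a}, a @: L = a @: K
      & forall j, (#|[set p in L | b p == j]| <= d j)%N].
  move=> rK r'K neq_r eq_r hallKr.
  have [|L [sL inj imL capL]] := IHn (K :\ r) _ hallKr.
    by rewrite (cardsD1 r) rK in ltKn.
  exists L; split=> //; first exact: subset_trans sL (subsetDl _ _).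
  by rewrite imL (image_D1 _ r').
have [|notp] := boolP (hall (K :\ p)); first exact: (remove p q).
have [|notq] := boolP (hall (K :\ q)); first by apply: (remove q p); rewrite // eq_sym.
(* If removing [r] breaks the condition, a violating set contains [a r]: the neighbourhood of any
   other set is unchanged. *)
have fails r r' : r \in K -> r' \in K -> r' != r -> a r = a r' -> ~~ hall (K :\ r) ->
    exists X : {set S}, [/\ X \subset a @: K, a r \in X
      & (\sum_(j in N (K :\ r) X) d j < #|X|)%N].
  move=> rK r'K neq_r eq_r /forallPn[X]; rewrite negb_imply (image_D1 _ r') // -ltnNge.
  move=> /andP[sX ltX]; exists X; split=> //; apply: contraLR ltX => arX.
  rewrite -leqNgt; have /implyP/(_ sX) := forallP hallK X.
  suff -> : N (K :\ r) X = N K X by [].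
  rewrite /N (_ : [set t in K :\ r | a t \in X] = [set t in K | a t \in X]) //.
  apply/setP => t; rewrite !inE.
  by case: eqVneq => // ->; rewrite (negPf arX) !andbF.
have [X [sX aX ltX]] := fails p q pK qK neq_qp eq_a notp.
have [Y [sY aY ltY]] : exists Y : {set S}, [/\ Y \subset a @: K, a q \in Y
      & (\sum_(j in N (K :\ q) Y) d j < #|Y|)%N] by apply: (fails q p); rewrite // eq_sym.
have hallU : (#|X :|: Y| <= \sum_(j in N (K :\ p) X :|: N (K :\ q) Y) d j)%N.
  have sXY : X :|: Y \subset a @: K by rewrite subUset sX.
  have /implyP/(_ sXY)/leq_trans := forallP hallK (X :|: Y); apply; apply: dS.
  apply/subsetP => _ /imsetP[r + ->]; rewrite inE => /andP[rK].
  have mem_N t (Z : {set S}) : r != t -> a r \in Z -> b r \in N (K :\ t) Z.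
    by move=> neq_t arZ; apply: imset_f; rewrite !inE neq_t rK.
  rewrite inE => /orP[arX|arY]; rewrite inE.
    have [eq_r|/mem_N-> //] := eqVneq r p.
    by rewrite orbC mem_N // eq_r ?[p == q]eq_sym // eq_a.
  have [eq_r|/(mem_N)->] := eqVneq r q; rewrite ?orbT //.
  by rewrite mem_N // eq_r // -eq_a.
have hallI : (#|(X :&: Y) :\ a p| <= \sum_(j in N (K :\ p) X :&: N (K :\ q) Y) d j)%N.
  have sXY : (X :&: Y) :\ a p \subset a @: K.
    by rewrite (subset_trans (subsetDl _ _)) // subIset // sX.
  have /implyP/(_ sXY)/leq_trans := forallP hallK ((X :&: Y) :\ a p); apply; apply: dS.
  apply/subsetP => _ /imsetP[r + ->]; rewrite !inE => /and4P[rK neq_ar arX arY].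
  apply/andP; split; apply: imset_f; rewrite !inE rK ?arX ?arY ?andbT.
    by apply: contraNneq neq_ar => ->.
  by apply: contraNneq neq_ar => ->; rewrite eq_a.
have := leq_add hallU hallI; rewrite -dU.
have := cardsUI X Y; rewrite [in LHS](cardsD1 (a p) (X :&: Y)) inE aX {1}eq_a aY /=.
move: ltX ltY; lia.
Qed.

(** * The order on layerings *)

Section Layerings.

Variables (R : realFieldType) (G : dag) (Fr : framing G) (alpha : vert G -> int).
Implicit Types (s t v : vert G) (e f : edge G) (P Q S : seq (edge G)).
Implicit Types (p q r : route G) (K L M N : {set route G}) (Ls : seq {set route G}).
Implicit Types (a : {set route G} -> R) (c : route G -> R) (x y : R).

Local Notation cons_edges := (consecutive (@esrc G) (@etgt G)).
Local Notation diverges_below := (first_diff (fun f g => out_le Fr (esrc f) f g)).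

Lemma diverges_below_trans v Q P S :
    sorted cons_edges P -> sorted cons_edges Q -> sorted cons_edges S ->
    starts_at P v -> starts_at Q v -> starts_at S v ->
  diverges_below P Q -> diverges_below Q S -> diverges_below P S.
Proof.
elim: P v Q S => [|e P IHP] v [|f Q] [|g S] //= Pp Qp Sp /eqP e_v /eqP f_v /eqP g_v.
have [_ anti trans _] := out_leP Fr (out_not_sink e).
have [eq_ef|neq_ef] := eqVneq e f; have [eq_fg|neq_fg] := eqVneq f g.
- rewrite eq_ef eq_fg eqxx in Pp Qp * => PQ QS.
  have [P_nil Q_nil] := first_diff_neq_nil PQ; have [_ S_nil] := first_diff_neq_nil QS.
  exact: (IHP _ Q S (path_sorted Pp) (path_sorted Qp) (path_sorted Sp)
    (path_starts_at Pp P_nil) (path_starts_at Qp Q_nil) (path_starts_at Sp S_nil)).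
- by rewrite eq_ef (negPf neq_fg).
- by rewrite -eq_fg (negPf neq_ef).
- move=> le_ef; rewrite f_v -e_v => le_fg.
  have out w : esrc w = v -> w \in out_edges (esrc e) by move=> w_v; rewrite mem_out e_v w_v.
  have [eq_eg|_] := eqVneq e g; last exact: (trans f _ _ (out _ f_v) (out _ e_v) (out _ g_v)).
  rewrite -eq_eg in le_fg; case/eqP: neq_ef.
  by apply: anti; rewrite ?le_ef //; apply: out.
Qed.

(** For distinct paths [first_diff] is undecided both ways only if one is a proper prefix of the
    other, which cannot happen when both end at sinks. *)
Lemma diverges_below_total e P f Q : path cons_edges e P -> path cons_edges f Q ->
    esrc e = esrc f -> is_sink (etgt (last e P)) -> is_sink (etgt (last f Q)) ->
    e :: P <> f :: Q ->
  diverges_below (e :: P) (f :: Q) || diverges_below (f :: Q) (e :: P).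
Proof.
elim: P e f Q => [|e' P IHP] e f Q Pp Qp eq_v Pl Ql /=; rewrite [f == e]eq_sym;
  (have [eq_ef neq|neq_ef _] := eqVneq e f; last by
    have [_ _ _ tot] := out_leP Fr (out_not_sink e); rewrite -eq_v; apply: tot;
    rewrite mem_out // eq_v).
- rewrite eq_ef in neq Pl; case: Q => [|g Q] // in Qp Ql neq *.
  by move: Qp (out_not_sink g) => /andP[/eqP <- _]; rewrite Pl.
- rewrite -eq_ef in Qp Ql neq; case: Q => [|g Q] in Qp Ql neq *.
    by move: Pp (out_not_sink e') => /andP[/eqP <- _]; rewrite Ql.
  move: Pp Qp => /andP[/eqP e'_v Pp] /andP[/eqP g_v Qp].
  by apply: IHP; rewrite // -?e'_v -?g_v //; move=> eq_PQ; apply: neq; rewrite eq_PQ.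
Qed.

Lemma lt_out_source s p q : starts_at p s -> starts_at q s ->
  lt_out Fr s p q = diverges_below p q.
Proof.
have after_source r : starts_at r s -> after r s = r.
  case eq_r: (r : seq _) => [|e S] //= /eqP <-.
  by have [_ -> _ _] := @route_portions _ r [::] e S eq_r.
by move=> p_s q_s; rewrite /lt_out !after_source.
Qed.

Lemma lt_out_source_trans s q p r : starts_at p s -> starts_at q s -> starts_at r s ->
  lt_out Fr s p q -> lt_out Fr s q r -> lt_out Fr s p r.
Proof.
move=> p_s q_s r_s; rewrite !lt_out_source //.
exact: (diverges_below_trans (route_sorted p) (route_sorted q) (route_sorted r) p_s q_s r_s).
Qed.

Lemma lt_out_source_total s p q : starts_at p s -> starts_at q s -> p != q ->
  lt_out Fr s p q || lt_out Fr s q p.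
Proof.
move=> p_s q_s neq_pq; rewrite !lt_out_source //.
have := route_sorted p; have := route_sorted q.
have p_last := @route_last _ p; have q_last := @route_last _ q.
have neq : (p : seq _) <> q by move=> eq_pq; case/eqP: neq_pq; apply/val_inj/val_inj.
case: (p : seq _) p_s p_last neq => [|e P] // /eqP e_s p_last.
case: (q : seq _) q_s q_last => [|f Q] // /eqP f_s q_last neq Qp Pp.
apply: diverges_below_total; rewrite ?e_s ?f_s //.
  exact: (p_last _ (belast e P) (lastI e P)).
exact: (q_last _ (belast f Q) (lastI f Q)).
Qed.

Lemma lt_out_irrefl s p : lt_out Fr s p p = false.
Proof. exact: first_diff_irrefl. Qed.

Lemma route_has_source p : exists s, is_source s && starts_at p s.
Proof. by have /and3P[_ /existsP] := route_isP p. Qed.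

Lemma route_has_sink p : exists s, is_sink s && ends_at p s.
Proof. by have /and3P[_ _ /existsP] := route_isP p. Qed.

Definition route_source p : vert G := xchoose (route_has_source p).
Definition route_sink p : vert G := xchoose (route_has_sink p).

Lemma route_source_is_source p : is_source (route_source p).
Proof. by have /andP[] := xchooseP (route_has_source p). Qed.

Lemma route_sink_is_sink p : is_sink (route_sink p).
Proof. by have /andP[] := xchooseP (route_has_sink p). Qed.

Lemma starts_atE p s : starts_at p s = (route_source p == s).
Proof.
have /andP[_] := xchooseP (route_has_source p); rewrite -/(route_source p).
by case: (p : seq _) => //= e P /eqP ->.
Qed.

Lemma ends_atE p s : ends_at p s = (route_sink p == s).
Proof.
have /andP[_] := xchooseP (route_has_sink p); rewrite -/(route_sink p).
by case: (p : seq _) => //= e P /eqP ->.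
Qed.

Lemma layering_route L s : is_layering alpha L -> is_source s ->
  exists p, route_from L s = [set p] /\ starts_at p s.
Proof.
case=> L_src _ /L_src/eqP/cards1P[p eq_p]; exists p; split=> //.
by have := set11 p; rewrite -eq_p inE => /andP[].
Qed.

Lemma layering_eq L M : (forall s, is_source s -> route_from L s = route_from M s) -> L = M.
Proof.
move=> eq_LM; apply/setP => p.
have := eq_LM _ (route_source_is_source p) => /setP/(_ p).
by rewrite !inE !starts_atE eqxx !andbT.
Qed.

Lemma layering_ltP L M : is_layering alpha L -> is_layering alpha M ->
  reflect (exists s p q, [/\ is_source s, route_from L s = [set p] /\ starts_at p s,
    route_from M s = [set q] /\ starts_at q s, lt_out Fr s p q
    & forall t, is_source t -> route_from L t <> route_from M t -> source_le Fr t s])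
  (layering_lt Fr L M).
Proof.
move=> layL layM; apply: (iffP existsP) => [[s /and4P[s_src _ /forallP max_s]]|].
  have [p [eq_p p_s]] := layering_route layL s_src.
  have [q [eq_q q_s]] := layering_route layM s_src.
  rewrite eq_p eq_q => /existsP[p' /andP[/set1P -> /existsP[q' /andP[/set1P -> lt_pq]]]].
  exists s, p, q; split=> // t t_src /eqP neq_t.
  by have := max_s t; rewrite t_src neq_t.
case=> s [p [q [s_src [eq_p p_s] [eq_q q_s] lt_pq max_s]]]; exists s.
rewrite s_src eq_p eq_q /=; apply/and3P; split.
- by apply: contraTneq lt_pq => /set1_inj ->; rewrite lt_out_irrefl.
- by apply/forallP => t; apply/implyP => /andP[t_src /eqP]; apply: max_s.
- by apply/existsP; exists p; rewrite set11; apply/existsP; exists q; rewrite set11.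
Qed.

(** The larger of the two deciding sources decides between [L] and [N]: above it all three layerings
    agree, and at it only one of the two comparisons changes the route, unless the deciding sources
    coincide. *)
Lemma layering_lt_trans M L N : is_layering alpha L -> is_layering alpha M ->
  is_layering alpha N -> layering_lt Fr L M -> layering_lt Fr M N -> layering_lt Fr L N.
Proof.
have [_ anti trans tot] := source_leP Fr.
move=> layL layM layN /layering_ltP-/(_ layL layM)[s [p [q [s_src Lp Mq lt_pq max_s]]]].
move=> /layering_ltP-/(_ layM layN)[t [q' [r [t_src Mq' Nr lt_qr max_t]]]].
apply/(layering_ltP layL layN).
have split_neq w : route_from L w <> route_from N w ->
    route_from L w <> route_from M w \/ route_from M w <> route_from N w.
  have [->|/eqP] := eqVneq (route_from L w) (route_from M w); [by right|by left].
have [eq_st|neq_st] := eqVneq s t.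
  have eq_q : q = q' by apply/set1_inj; rewrite -Mq.1 eq_st -Mq'.1.
  rewrite -eq_q -eq_st in lt_qr Nr; exists s, p, r; split=> //.
    exact: (lt_out_source_trans Lp.2 Mq.2 Nr.2 lt_pq).
  by move=> w w_src /split_neq[/max_s->|/max_t]//; rewrite eq_st; apply.
have [le_st|le_ts] := orP (tot s t s_src t_src).
  have eq_t : route_from L t = route_from M t.
    apply/eqP; apply: contraNT neq_st => /eqP/(max_s _ t_src) le_ts.
    by apply/eqP/anti => //; rewrite le_st.
  exists t, q', r; split=> //; first by rewrite eq_t.
  move=> w w_src /split_neq[/max_s le_ws|/max_t->//].
  exact: (trans _ _ _ s_src w_src t_src (le_ws w_src)).
have eq_s : route_from M s = route_from N s.
  apply/eqP; apply: contraNT neq_st => /eqP/(max_t _ s_src) le_st.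
  by apply/eqP/anti => //; rewrite le_st.
exists s, p, q; split=> //; first by rewrite -eq_s.
move=> w w_src /split_neq[/max_s->//|/max_t le_wt].
exact: (trans _ _ _ t_src w_src s_src (le_wt w_src)).
Qed.

Lemma layering_lt_asym L M : is_layering alpha L -> is_layering alpha M ->
  layering_lt Fr L M -> layering_lt Fr M L -> False.
Proof.
move=> layL layM ltLM ltML.
have /(layering_ltP layL layL)[s [p [q [_ [eq_p _] [eq_q _]]]]] :=
  layering_lt_trans layL layM layL ltLM ltML.
by rewrite (set1_inj (etrans (esym eq_p) eq_q)) lt_out_irrefl.
Qed.

Lemma layering_lt_total L M : is_layering alpha L -> is_layering alpha M -> L <> M ->
  layering_lt Fr L M || layering_lt Fr M L.
Proof.
move=> layL layM neq_LM; have [_ _ trans tot] := source_leP Fr.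
pose D := [set s | is_source s && (route_from L s != route_from M s)].
have D_neq0 : D != set0.
  apply: contra_notN neq_LM => /eqP D0; apply: layering_eq => s s_src; apply/eqP.
  by have := in_set0 s; rewrite -D0 inE s_src => /negbT; rewrite negbK.
have D_src s : s \in D -> is_source s by rewrite inE => /andP[].
have [||s sD max_s] := @exists_least _ D (fun s t => source_le Fr t s) D_neq0.
- by move=> y x z /D_src ? /D_src ? /D_src ? h1 h2; apply: (trans y).
- by move=> x y /D_src ? /D_src ?; apply: tot.
have s_src := D_src s sD; move: sD; rewrite inE s_src => neq_s.
have [p [eq_p p_s]] := layering_route layL s_src.
have [q [eq_q q_s]] := layering_route layM s_src.
rewrite eq_p eq_q in neq_s; have neq_pq : p != q by apply: contraNneq neq_s => ->.
have max t : is_source t -> route_from L t <> route_from M t -> source_le Fr t s.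
  by move=> t_src /eqP neq_t; apply: max_s; rewrite inE t_src.
have [lt_pq|lt_qp] := orP (lt_out_source_total p_s q_s neq_pq).
  by apply/orP; left; apply/(layering_ltP layL layM); exists s, p, q.
apply/orP; right; apply/(layering_ltP layM layL); exists s, q, p; split=> // t t_src neq_t.
by apply: max => // eq_t; apply: neq_t.
Qed.

(** Collects the layerings, given by a proposition, into a finite set to which [exists_least]
    applies. *)
Lemma layering_decidable : exists lay : {set {set route G}},
  forall L, L \in lay <-> is_layering alpha L.
Proof.
exists [set L : {set route G} | [forall s, is_source s ==> (#|[set p in L | starts_at p s]| == 1%N)]
  && [forall j, is_sink j ==> (#|[set p in L | ends_at p j]| == `|alpha j|%N)]] => L.
rewrite inE; split=> [/andP|] [L_src L_snk]; [|apply/andP]; split.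
- by move=> s s_src; apply/eqP; move/forallP/(_ s): L_src; rewrite s_src.
- by move=> s s_src; apply/eqP; move/forallP/(_ s): L_snk; rewrite s_src.
- by apply/forallP => s; apply/implyP => /L_src/eqP.
- by apply/forallP => s; apply/implyP => /L_snk/eqP.
Qed.

Lemma min_layering_exists K L : is_layering alpha L -> L \subset K ->
  exists M, is_min_layering Fr alpha K M.
Proof.
have [lay layP] := layering_decidable; move=> layL sLK.
pose A := [set M in lay | M \subset K].
have A_lay M : M \in A -> is_layering alpha M by rewrite inE => /andP[/layP].
have A_neq0 : A != set0 by apply/set0Pn; exists L; rewrite inE sLK andbT; apply/layP.
have [|| M MA min_M] := @exists_least _ A (fun M N => (M == N) || layering_lt Fr M N) A_neq0.
- move=> N M' N' /A_lay layN /A_lay layM' /A_lay layN'.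
  move=> /predU1P[->//|lt1] /predU1P[<-|lt2]; rewrite ?lt1 ?orbT //.
  by rewrite (layering_lt_trans layM' layN layN') ?orbT.
- move=> M N /A_lay layM /A_lay layN; have [->//|/eqP neq_MN] := eqVneq M N.
  by have /orP[->|->] := layering_lt_total layM layN neq_MN; rewrite ?orbT.
exists M; move: (MA); rewrite inE => /andP[/layP layM sMK]; split=> // N layN sNK neq_NM.
have NA : N \in A by rewrite inE sNK andbT; apply/layP.
by have := min_M _ NA; rewrite eq_sym (negPf neq_NM).
Qed.

Lemma min_layering_unique K L M :
  is_min_layering Fr alpha K L -> is_min_layering Fr alpha K M -> L = M.
Proof.
move=> [layL sLK minL] [layM sMK minM]; apply/eqP; apply: contraT => neq_LM.
case: (layering_lt_asym layL layM); first by apply: minL; rewrite // eq_sym.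
exact: minM.
Qed.

(** * Layerings inside balanced weights *)

(** The marginals of [y] times a layering: [c] is a fractional layering scaled by [y]. *)
Definition balanced c y :=
  (forall s, is_source s -> \sum_(p : route G | starts_at p s) c p = y) /\
  (forall j, is_sink j -> \sum_(p : route G | ends_at p j) c p = y *+ `|alpha j|%N).

(** Hall's condition holds because the weight [y *+ #|X|] starting in a set [X] of sources must end
    in sinks reachable from [X] within the support, whose total capacity is [y] times the sum of the
    [d j]. *)
Lemma balanced_layering c y : (forall p, 0 <= c p) -> 0 < y -> balanced c y ->
  exists2 L, is_layering alpha L & L \subset [set p | 0 < c p].
Proof.
move=> c_ge0 y_gt0 [c_src c_snk]; set K := [set p | 0 < c p].
pose d j := `|alpha j|%N.
have sum_src (X : {set vert G}) : X \subset [set s | is_source s] ->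
    y *+ #|X| = \sum_(p : route G | route_source p \in X) c p.
  move=> /subsetP sX; rewrite (partition_big route_source (mem X)) //=.
  rewrite -sumr_const; apply: eq_bigr => s sX'.
  rewrite -(c_src s); last by have := sX s sX'; rewrite inE.
  by apply: eq_bigl => p; rewrite starts_atE andbC; case: eqVneq => // ->; rewrite sX'.
have sum_snk (X : {set vert G}) : X \subset [set s | is_sink s] ->
    y *+ (\sum_(j in X) d j) = \sum_(p : route G | route_sink p \in X) c p.
  move=> /subsetP sX; rewrite (partition_big route_sink (mem X)) //=.
  rewrite -sumrMnr; apply: eq_bigr => s sX'.
  rewrite -(c_snk s); last by have := sX s sX'; rewrite inE.
  by apply: eq_bigl => p; rewrite ends_atE andbC; case: eqVneq => // ->; rewrite sX'.
have K_src : route_source @: K = [set s | is_source s].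
  apply/setP => s; rewrite inE; apply/imsetP/idP => [[p _ ->]|s_src].
    exact: route_source_is_source.
  have : 0 < \sum_(p : route G | starts_at p s) c p by rewrite c_src.
  rewrite lt0r psumr_neq0 // => /andP[/hasP[p _ /andP[p_s p_gt0]] _].
  by exists p; [rewrite inE | apply/eqP; rewrite eq_sym -starts_atE].
have [X sX|L [sLK L_inj L_src L_snk]] := @capacitated_hall _ _ _ route_source route_sink d K.
  rewrite K_src in sX; rewrite -(ler_pMn2l y_gt0) sum_src // sum_snk; last first.
    by apply/subsetP => _ /imsetP[p _ ->]; rewrite inE route_sink_is_sink.
  rewrite big_mkcond [leRHS]big_mkcond ler_sum // => p _.
  case: ifP => pX; last by case: ifP.
  case: ifP => // /negbT pN; have := c_ge0 p; rewrite le0r => /predU1P[->//|p_gt0].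
  by case/negP: pN; apply/imsetP; exists p; rewrite // !inE p_gt0.
exists L => //; split=> [s s_src|j j_snk].
  have : s \in route_source @: L by rewrite L_src K_src inE.
  case/imsetP => p pL eq_s; apply/eqP/cards1P; exists p; apply/setP => q.
  rewrite !inE starts_atE eq_s; apply/andP/eqP => [[qL /eqP/L_inj->]|->] //.
have card_L : (\sum_(j | is_sink j) #|[set p in L | route_sink p == j]| = #|L|)%N.
  rewrite -[RHS]sum1_card (partition_big route_sink (@is_sink G)) => [|p _]; last first.
    exact: route_sink_is_sink.
  apply: eq_bigr => i _; rewrite -sum1_card; by apply: eq_bigl => p; rewrite inE.
have sum_d : (#|L| = \sum_(j | is_sink j) d j)%N.
  rewrite -(card_in_imset L_inj) L_src K_src; apply: (mulrIn (lt0r_neq0 y_gt0)).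
  rewrite sum_src // (eq_bigl (fun j => j \in [set s : vert G | is_sink s])).
    rewrite sum_snk //; apply: eq_bigl => p.
    by rewrite !inE route_source_is_source route_sink_is_sink.
  by move=> i; rewrite inE.
have capL i : is_sink i -> (#|[set p in L | route_sink p == i]| <= d i
    ?= iff (#|[set p in L | route_sink p == i]| == d i))%N by move=> _; apply/leqif_eq/L_snk.
(* Hall only bounds the number of routes at each sink from above; the totals agree, so every bound
   is an equality. *)
have [_] := leqif_sum capL; rewrite card_L sum_d eqxx => /esym/forall_inP/(_ j j_snk)/eqP eq_d.
by rewrite -[RHS]eq_d; congr #|pred_of_set _|; apply/setP => p; rewrite !inE ends_atE.
Qed.

End Layerings.

(** * Greedy decomposition into layerings *)

Section Greedy.

Variables (R : realFieldType) (G : dag) (Fr : framing G) (alpha : vert G -> int).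
Implicit Types (p q : route G) (L M : {set route G}) (Ls : seq {set route G}).
Implicit Types (a : {set route G} -> R) (c : route G -> R) (y : R).

(** Conditions (2) and (3) of a layering-simplex, worded as in [layering_simplex]. *)
Definition greedy_chain Ls := forall Ls1 Ls2 L, Ls = Ls1 ++ L :: Ls2 ->
  is_min_layering Fr alpha (routes (L :: Ls2)) L /\ exists2 p, p \in L & p \notin routes Ls2.

Definition route_weight a Ls p : R := \sum_(L <- Ls) a L * (p \in L)%:R.

Lemma routes_cons L Ls : routes (L :: Ls) = L :|: routes Ls.
Proof. by rewrite /routes big_cons. Qed.

Lemma mem_routes Ls L p : L \in Ls -> p \in L -> p \in routes Ls.
Proof.
elim: Ls => // M Ls IHLs; rewrite inE routes_cons in_setU.
by case/predU1P => [<- ->//|/IHLs IH /IH->]; rewrite orbT.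
Qed.

Lemma greedy_chain_cons L Ls : greedy_chain (L :: Ls) <->
  [/\ is_min_layering Fr alpha (routes (L :: Ls)) L,
      exists2 p, p \in L & p \notin routes Ls & greedy_chain Ls].
Proof.
split=> [chain|[minL newL chain]].
  have [? ?] := chain [::] Ls L erefl; split=> // Ls1 Ls2 M eq_Ls.
  by apply: (chain (L :: Ls1)); rewrite eq_Ls.
by case=> [|M Ls1] Ls2 M' []; [move=> <- <- | move=> _; apply: chain].
Qed.

Lemma greedy_chain_uniq Ls : greedy_chain Ls -> uniq Ls.
Proof.
elim: Ls => //= L Ls IHLs /greedy_chain_cons[_ [p pL p_new] /IHLs->].
by rewrite andbT; apply: contra p_new => /mem_routes; apply.
Qed.

Lemma route_weight_ge0 a Ls p : {in Ls, forall L, 0 < a L} -> 0 <= route_weight a Ls p.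
Proof.
by move=> a_gt0; rewrite /route_weight big_seq sumr_ge0 // => L /a_gt0/ltW ?; rewrite mulr_ge0.
Qed.

Lemma route_weight_gt0 a Ls p : {in Ls, forall L, 0 < a L} ->
  (0 < route_weight a Ls p) = (p \in routes Ls).
Proof.
elim: Ls => [|L Ls IHLs] a_gt0; first by rewrite /route_weight /routes !big_nil ltxx inE.
have a_gt0' : {in Ls, forall L, 0 < a L} by move=> M MLs; apply: a_gt0; rewrite inE MLs orbT.
rewrite routes_cons inE -IHLs // /route_weight big_cons.
case: (p \in L); last by rewrite mulr0 add0r.
by rewrite mulr1 ltr_wpDr ?a_gt0 ?mem_head ?route_weight_ge0.
Qed.

Lemma route_weight_notin a Ls p : p \notin routes Ls -> route_weight a Ls p = 0.
Proof.
move=> p_new; rewrite /route_weight big_seq big1 // => L LLs.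
by case: (boolP (p \in L)) p_new => [/(mem_routes LLs)->|]; rewrite ?mulr0.
Qed.

Lemma sum_indicator L (P : pred (route G)) :
  \sum_(p | P p) (p \in L)%:R = #|[set p in L | P p]|%:R :> R.
Proof.
rewrite -sum1_card natr_sum big_mkcond [RHS]big_mkcond; apply: eq_bigr => p _.
by rewrite inE; case: (P p); case: (p \in L).
Qed.

Lemma balanced_sub c y L (m : R) : is_layering alpha L -> balanced alpha c y ->
  balanced alpha (fun p => c p - m * (p \in L)%:R) (y - m).
Proof.
move=> [L_src L_snk] [c_src c_snk]; split=> [s s_src|j j_snk].
  by rewrite sumrB -mulr_sumr sum_indicator L_src // c_src // mulr1.
by rewrite sumrB -mulr_sumr sum_indicator L_snk // c_snk // mulr_natr mulrnBl.
Qed.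

(** Induction on the support of [c]: remove as much as possible of its least layering [L]. The
    support is always the set of routes of the resulting list, which gives condition (2), and the
    route that is used up gives condition (3). Coefficients arise by subtraction only, so they stay
    in [S]. *)
Lemma greedy_decomposition_exists c y : (forall p, 0 <= c p) -> balanced alpha c y ->
  exists Ls a, [/\ {in Ls, forall L, is_layering alpha L}, sorted (layering_lt Fr) Ls,
    greedy_chain Ls, {in Ls, forall L, 0 < a L} /\ (forall p, c p = route_weight a Ls p)
    & forall S : zmodClosed R, (forall p, c p \in S) -> {in Ls, forall L, a L \in S}].
Proof.
have [n] := ubnP #|[set p | 0 < c p]|; elim: n => // n IHn in c y *.
move=> lt_n c_ge0 c_bal.
have [K0|[p0]] := set_0Vmem [set p | 0 < c p].
  exists [::], (fun=> 0); split=> //; first by move=> [].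
  split=> // p; rewrite /route_weight big_nil; apply/eqP; rewrite eq_le c_ge0 andbT leNgt.
  by have := in_set0 p; rewrite -K0 inE => ->.
rewrite inE => p0_gt0.
have y_gt0 : 0 < y.
  rewrite -(c_bal.1 _ (route_source_is_source p0)).
  by apply: lt_le_trans p0_gt0 _; rewrite (bigD1 p0) ?starts_atE //= lerDl sumr_ge0.
have [L0 layL0 sL0] := balanced_layering c_ge0 y_gt0 c_bal.
have [L minL] := min_layering_exists Fr layL0 sL0; have [layL sLK minLK] := minL.
have L_neq0 : L != set0.
  have [p [eq_p _]] := layering_route layL (route_source_is_source p0).
  by apply/set0Pn; exists p; have := set11 p; rewrite -eq_p inE => /andP[].
have [||q qL min_q] := @exists_least _ L (fun p p' => c p <= c p') L_neq0.
- by move=> ? ? ? _ _ _; apply: le_trans.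
- by move=> ? ? _ _; apply: le_total.
pose c' p := c p - c q * (p \in L)%:R.
have q_gt0 : 0 < c q by have := subsetP sLK q qL; rewrite inE.
have c'_ge0 p : 0 <= c' p.
  by rewrite /c'; case pL: (p \in L); rewrite ?mulr0 ?subr0 // mulr1 subr_ge0 min_q.
have c'q : c' q = 0 by rewrite /c' qL mulr1 subrr.
have sK' : [set p | 0 < c' p] \subset [set p | 0 < c p].
  apply/subsetP => p; rewrite !inE => /lt_le_trans; apply.
  by rewrite gerBl mulr_ge0 // ltW.
have [||Ls [a [lay srt chain [a_gt0 c'E] aS]]] := IHn c' (y - c q) _ c'_ge0.
- rewrite -ltnS; apply: leq_trans lt_n; rewrite ltnS; apply: proper_card.
  by apply/properP; split=> //; exists q; rewrite inE ?c'q ?ltxx.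
- exact: balanced_sub.
have routesLs : routes Ls = [set p | 0 < c' p].
  by apply/setP => p; rewrite inE c'E route_weight_gt0.
have q_new : q \notin routes Ls by rewrite routesLs inE c'q ltxx.
have L_new : L \notin Ls by apply: contra q_new => /mem_routes; apply.
have routesL : routes (L :: Ls) = [set p | 0 < c p].
  rewrite routes_cons routesLs; apply/eqP; rewrite eqEsubset subUset sLK sK' /=.
  apply/subsetP => p; rewrite !inE /c'; case: (p \in L) => //=.
  by rewrite mulr0 subr0.
pose a' M := if M == L then c q else a M.
have a'E M : M \in Ls -> a' M = a M.
  by rewrite /a'; case: eqVneq => // ->; rewrite (negPf L_new).
have a'L : a' L = c q by rewrite /a' eqxx.
exists (L :: Ls), a'; split.
- by move=> M; rewrite inE => /predU1P[->//|/lay].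
(* The next layering lies in the smaller support and differs from [L], so minimality of [L] puts it
   above [L]. *)
- case: Ls => [|M Ls] //= in lay srt chain a_gt0 c'E aS routesLs q_new L_new routesL a'E *.
  rewrite srt andbT; apply: minLK; first by apply: lay; rewrite mem_head.
    by apply: subset_trans sK'; rewrite -routesLs routes_cons subsetUl.
  by apply: contraNneq L_new => ->; rewrite mem_head.
- by apply/greedy_chain_cons; split=> //; [rewrite routesL|exists q].
- split=> [M|p]; first by rewrite inE => /predU1P[->|MLs]; rewrite ?a'L ?a'E ?a_gt0.
  rewrite /route_weight big_cons a'L big_seq.
  under eq_bigr => M MLs do rewrite a'E //.
  by rewrite -big_seq -[X in _ + X]/(route_weight a Ls p) -c'E /c' addrC subrK.
- move=> S cS M; rewrite inE => /predU1P[->|MLs]; first by rewrite a'L.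
  rewrite a'E //; apply: aS => // p; rewrite /c'; case: (p \in L).
    by rewrite mulr1 rpredB.
  by rewrite mulr0 subr0.
Qed.

(** The weights determine the support, and so the first layering [L] as its least one. The
    coefficient of [L] is at most the weight of each route of [L], with equality at the route that
    condition (3) provides; applied to both lists, this equates the coefficients, and [L] can be
    cancelled. *)
Lemma greedy_decomposition_unique Ls Ls' a a' :
    greedy_chain Ls -> greedy_chain Ls' ->
    {in Ls, forall L, 0 < a L} -> {in Ls', forall L, 0 < a' L} ->
    route_weight a Ls =1 route_weight a' Ls' ->
  Ls = Ls' /\ {in Ls, a =1 a'}.
Proof.
elim: Ls Ls' => [|L Ls IHLs] [|L' Ls'] //.
- move=> _ /greedy_chain_cons[_ [p pL' _] _] _ a'_gt0 /(_ p) /esym.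
  have : 0 < route_weight a' (L' :: Ls') p.
    by rewrite route_weight_gt0 // (mem_routes _ pL') ?mem_head.
  by move=> /[swap] ->; rewrite /route_weight big_nil ltxx.
- move=> /greedy_chain_cons[_ [p pL _] _] _ a_gt0 _ /(_ p).
  have : 0 < route_weight a (L :: Ls) p.
    by rewrite route_weight_gt0 // (mem_routes _ pL) ?mem_head.
  by move=> /[swap] ->; rewrite /route_weight big_nil ltxx.
move=> chainL chainL' a_gt0 a'_gt0 eq_w.
have eq_routes : routes (L :: Ls) = routes (L' :: Ls').
  apply/setP => p; rewrite -(route_weight_gt0 _ a_gt0) -(route_weight_gt0 _ a'_gt0).
  by rewrite eq_w.
have uniqL := greedy_chain_uniq chainL; have uniqL' := greedy_chain_uniq chainL'.
move: chainL chainL' => /greedy_chain_cons[minL [p pL p_new] chain].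
move=> /greedy_chain_cons[minL' [p' pL' p'_new] chain'].
have eq_L : L = L' by apply: min_layering_unique minL'; rewrite -eq_routes.
rewrite -{}eq_L in pL' eq_w a'_gt0 uniqL' *.
have a_gt0' : {in Ls, forall L, 0 < a L} by move=> M MLs; apply: a_gt0; rewrite inE MLs orbT.
have a'_gt0' : {in Ls', forall L, 0 < a' L} by move=> M MLs; apply: a'_gt0; rewrite inE MLs orbT.
have weight_cons b Ms q : route_weight b (L :: Ms) q = b L * (q \in L)%:R + route_weight b Ms q.
  by rewrite /route_weight big_cons.
have eq_a : a L = a' L.
  apply/eqP; rewrite eq_le; apply/andP; split.
    have := eq_w p'; rewrite !weight_cons pL' !mulr1 (route_weight_notin _ p'_new) addr0 => <-.
    by rewrite lerDl route_weight_ge0.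
  have := eq_w p; rewrite !weight_cons pL !mulr1 (route_weight_notin _ p_new) addr0 => ->.
  by rewrite lerDl route_weight_ge0.
have [|<- eq_as] := IHLs Ls' chain chain' a_gt0' a'_gt0'.
  by move=> q; have := eq_w q; rewrite !weight_cons eq_a => /addrI.
by split=> // M; rewrite inE => /predU1P[->|/eq_as].
Qed.

End Greedy.

(** * From route weights to layering combinations *)

Lemma layering_combination (R : realType) (G : dag) (a : {set route G} -> R)
    (Ls : seq {set route G}) (e : edge G) :
  \sum_(L <- Ls) a L * layering_indicator R L e
  = \sum_(p : route G) route_weight a Ls p * (e \in (p : seq _))%:R.
Proof.
under [RHS]eq_bigr do rewrite mulr_suml.
rewrite exchange_big /=; apply: eq_bigr => L _; rewrite /layering_indicator mulr_sumr.
rewrite big_mkcond /=; apply: eq_bigr => p _; rewrite /indicator.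
by case: (p \in L); rewrite ?mulr1 // mulr0 mul0r.
Qed.

Lemma sum_starts_at (R : realFieldType) (G : dag) (F : edge G -> R) (c : route G -> R)
    (s : vert G) : is_source s ->
    (forall e, F e = \sum_(p : route G) c p * (e \in (p : seq _))%:R) ->
  \sum_(p : route G | starts_at p s) c p = \sum_(e in out_edges s) F e.
Proof.
move=> s_src Fc; under [RHS]eq_bigr do rewrite Fc.
rewrite exchange_big big_mkcond /=; apply: eq_bigr => p _.
by rewrite -mulr_sumr sum_out_source //; case: starts_at; rewrite ?mulr1 ?mulr0.
Qed.

Lemma sum_ends_at (R : realFieldType) (G : dag) (F : edge G -> R) (c : route G -> R)
    (j : vert G) : is_sink j ->
    (forall e, F e = \sum_(p : route G) c p * (e \in (p : seq _))%:R) ->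
  \sum_(p : route G | ends_at p j) c p = \sum_(e in in_edges j) F e.
Proof.
move=> j_snk Fc; under [RHS]eq_bigr do rewrite Fc.
rewrite exchange_big big_mkcond /=; apply: eq_bigr => p _.
by rewrite -mulr_sumr sum_in_sink //; case: ends_at; rewrite ?mulr1 ?mulr0.
Qed.

Theorem theorem3p18 (R : realType) (G : dag) (alpha : vert G -> int)
    (Fr : framing G) (x : R) (F : edge G -> R)
    (alphaP : conservationist alpha) (x_gt0 : 0 < x)
    (flowF : is_flow x alpha F) :
  exists (LL : {set {set route G}}) (a : {set route G} -> R),
    [/\ positive_combination Fr alpha LL a F,
        forall (LL' : {set {set route G}}) (a' : {set route G} -> R),
          positive_combination Fr alpha LL' a' F ->
          LL' = LL /\ {in LL, a' =1 a}
      & (forall e : edge G, F e \is a Num.int) ->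
        {in LL, forall L, a L \is a Num.int}].
Proof.
case: flowF => F_ge0 F_net.
have F_cons v : is_internal v -> \sum_(e in out_edges v) F e = \sum_(e in in_edges v) F e.
  move=> v_int; have [_ _ /(_ v_int) alpha0] := alphaP v.
  by apply/eqP; rewrite -subr_eq0 F_net alpha0 mulr0.
pose c (p : route G) := mass Fr F p.
have F_c e : F e = \sum_p c p * (e \in (p : seq _))%:R := flow_mass Fr F_ge0 F_cons e.
(* Next, the routes at a source carry its outflow and those at a sink its inflow, so the netflow
   equations say that [c] is balanced with [y] equal to [x]. *)
have c_ge0 p : 0 <= c p := mass_ge0 Fr F_ge0 p.
have c_bal : balanced alpha c x.
  split=> [s s_src|j j_snk].
    rewrite (sum_starts_at s_src F_c); have [/(_ s_src) alpha1 _ _] := alphaP s.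
    have := F_net s; rewrite alpha1 mulr1 => <-.
    by rewrite [X in _ - X]big_pred0 ?subr0 // => e; move: s_src => /eqP->; rewrite inE.
  rewrite (sum_ends_at j_snk F_c); have [_ /(_ j_snk) alpha_lt0 _] := alphaP j.
  have := F_net j; rewrite big_pred0 => [|e]; last by move: j_snk => /eqP->; rewrite inE.
  rewrite sub0r => /(canRL (@opprK _)) ->.
  by rewrite -{1}[alpha j]opprK -(ltz0_abs alpha_lt0) mulrNz mulrN opprK -pmulrn mulr_natr.
have sum_LL (LL : {set {set route G}}) Ls (f : {set route G} -> R) :
    uniq Ls -> LL = [set L in Ls] -> \sum_(L in LL) f L = \sum_(L <- Ls) f L.
  by move=> uniqLs ->; rewrite big_uniq //; apply: eq_bigl => L; rewrite inE.
have [Ls [a [lay srt chain [a_gt0 cE] aS]]] := greedy_decomposition_exists Fr c_ge0 c_bal.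
have routesLs : routes Ls = [set p | 0 < c p].
  by apply/setP => p; rewrite inE cE route_weight_gt0.
exists [set L in Ls], a; split.
- split=> [|L|e]; last 1 first.
  + rewrite (sum_LL _ Ls) ?(greedy_chain_uniq chain) // layering_combination F_c.
    by apply: eq_bigr => p _; rewrite cE.
  + exists Ls; split=> //; rewrite routesLs; exact: mass_clique.
  + by rewrite inE => /a_gt0.
- move=> LL' a' [[Ls' [-> lay' srt' clique' chain']] a'_gt0 F_a'].
  have {}a'_gt0 : {in Ls', forall L, 0 < a' L} by move=> L LLs; apply: a'_gt0; rewrite inE.
  have uniqLs' : uniq Ls' := greedy_chain_uniq chain'.
  have F_w e : F e = \sum_p route_weight a' Ls' p * (e \in (p : seq _))%:R.
    by rewrite F_a' (sum_LL _ Ls') //= layering_combination.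
  (* The route weights of the competing combination form a clique decomposition of [F], hence equal
     the masses, and the greedy decomposition of the masses is unique. *)
  have [|<- eq_a] := greedy_decomposition_unique chain' chain a'_gt0 a_gt0.
    move=> p; rewrite -cE; apply: (clique_decomposition_unique F_ge0 F_cons _ _ F_w).
      by move=> q; apply: route_weight_ge0.
    suff -> : [set q | 0 < route_weight a' Ls' q] = routes Ls' by [].
    by apply/setP => q; rewrite inE route_weight_gt0.
  by split=> // L; rewrite inE => /eq_a.
- move=> F_int L; rewrite inE => LLs.
  (* Integrality passes from [F] to the masses and from these to the coefficients; [Num.int] is the
     subgroup [S] in both steps. *)
  by apply: aS => // p; apply: mass_zmod => e; apply: F_int.
Qed.
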